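(* Let $\theta\in(0,1)$, let $u_0\in L^1(0,\infty)$ satisfy $\sup_{0<x<1}x^\theta|u_0(x)|+\sup_{x>1}|u_0(x)|<\infty$, and let $(u,p_c)$ be the solution pair with $u(0)=u_0$ described in the context. Define $$N(t)=\int_0^\infty n_0(x)(1+n_0(x))u(t,x)x^4dx,\qquad E(t)=\int_0^\infty n_0(x)(1+n_0(x))u(t,x)x^6dx .$$ Then $$E(t)=E(0)\quad\forall t>0,\qquad p_c(t)+N(t)=p_c(0)+N(0)\quad\forall t>0.$$
   Context: For $x,y>0$, $x\ne y$, let $$M(x,y)=\Big(\frac1{\sinh|x^2-y^2|}-\frac1{\sinh(x^2+y^2)}\Big)\frac{y^3\sinh x^2}{x^3\sinh y^2},\qquad \mathcal L(g)(x)=\int_0^\infty(g(y)-g(x))M(x,y)\,dy .$$ $n_0$ is the equilibrium $n_0(p)=(e^{\beta_0|p|^2}-1)^{-1}$ ($\beta_0>0$ fixed) in the variable $x=\sqrt{\beta_0}|p|/\sqrt2$, so that $n_0(x)(1+n_0(x))=\frac1{4\sinh^2(x^2)}$. Solution pair: $u\in C([0,\infty);L^1(0,\infty))\cap L^\infty((\delta,\infty);L^\infty(0,\infty))$ for all $\delta>0$, $p_c\in C([0,\infty))$, $p_c>0$, $u(0)=u_0$; $u(t)$ is locally Lipschitz on $(0,\infty)$ for each $t>0$; $\partial_tu,\ \mathcal L(u)\in L^\infty_{loc}((0,\infty)\times(0,\infty))\cap L^1((0,T);L^1(0,\infty))$ for all $T>0$; for almost every $t>0,x>0$ $$\partial_tu(t,x)=p_c(t)\mathcal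 L(u(t))(x),\qquad p_c'(t)=-p_c(t)\int_0^\infty\mathcal L(u(t))(x)\,n_0(x)(1+n_0(x))x^4dx;$$ and for all $\beta,\delta\in(0,1)$ there is a constant $C$ with $$|\partial_xu(t,x)|\le C\Big(\lambda(t,x)(|||u_0|||_\theta+\|u_0\|_1)+\sup_{0\le s\le t}(|||u(s)|||_\theta+\|u(s)\|_1)\int_0^t\lambda(s,x)ds\Big),$$ where $|||g|||_\theta=\sup_{0<x<1}x^\theta|g(x)|+\sup_{x>1}|g(x)|$, $\lambda(t,x)=\tilde\lambda(\int_0^tp_c(s)ds,x)$ and $\tilde\lambda(\tau,x)=x^{-1+\delta}\tau^{-\theta-\delta}$ if $0<x<\tau<1$, $\tilde\lambda(\tau,x)=\tau^2$ if $\tau>1$, $0<x<\tau$, and $\tilde\lambda(\tau,x)=x^{-1-\beta}\tau^{\beta-1}$ if $x>\tau$. *)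

(* Defs.v *)
From HB Require Import structures.
From mathcomp Require Import all_boot all_order all_algebra.
From mathcomp Require Import all_classical all_reals all_analysis.
From mathcomp Require Import ring lra.

Set Implicit Arguments.
Unset Strict Implicit.
Unset Printing Implicit Defensive.
Import Order.TTheory GRing.Theory Num.Theory.
Import numFieldNormedType.Exports.

Local Open Scope classical_set_scope.
Local Open Scope ring_scope.

Section Kernel.
Context {R : realType}.
Implicit Types (x y : R) (g : R -> R).

Let mu := @lebesgue_measure R.

Definition pos : set R := `]0, +oo[.

Definition sinh x : R := (expR x - expR (- x)) / 2.

(* On the null set x = y the convention 0^-1 = 0 makes M x y finite; this
   affects no integral. *)
Definition M x y : R :=
  ((sinh `|x ^+ 2 - y ^+ 2|)^-1 - (sinh (x ^+ 2 + y ^+ 2))^-1) *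
  ((y ^+ 3 * sinh (x ^+ 2)) / (x ^+ 3 * sinh (y ^+ 2))).

Definition L g x : R := \int[mu]_(y in pos) ((g y - g x) * M x y).

Definition n0_momentum (beta0 r : R) : R := (expR (beta0 * r ^+ 2) - 1)^-1.

(* n0_momentum at the radius r = |p| for which x = sqrt beta0 * r / sqrt 2. *)
Definition n0 (beta0 x : R) : R :=
  n0_momentum beta0 (Num.sqrt 2 * x / Num.sqrt beta0).

Lemma n0_1n0E (beta0 x : R) : 0 < beta0 -> x != 0 ->
  n0 beta0 x * (1 + n0 beta0 x) = (4 * sinh (x ^+ 2) ^+ 2)^-1.
Proof.
move=> b0 x0; rewrite /n0 /n0_momentum.
have -> : beta0 * (Num.sqrt 2 * x / Num.sqrt beta0) ^+ 2 = x ^+ 2 + x ^+ 2.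
  rewrite !exprMn exprVn !sqr_sqrtr ?ltW//.
  by rewrite mulrC divfK ?gt_eqF// mulr2n mulrDl mul1r.
rewrite expRD /sinh expRN.
have y1 : expR (x ^+ 2) > 1.
  by rewrite expR_gt1 exprn_even_gt0.
set y := expR _ in y1 *.
have y0 : y != 0 by rewrite gt_eqF// (lt_trans ltr01).
have yy : y * y - 1 != 0.
  by rewrite subr_eq0 gt_eqF// -(mulr1 1) ltr_pM.
field.
by rewrite y0 yy; apply/andP; split.
Qed.

Definition moment (beta0 : R) (k : nat) g : R :=
  \int[mu]_(x in pos) (n0 beta0 x * (1 + n0 beta0 x) * g x * x ^+ k).

End Kernel.

Section WeakDerivatives.
Context {R : realType}.

Let mu := @lebesgue_measure R.

(* Test functions on (0, oo): smooth on R, with compact support in (0, oo). *)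
Definition test1 (phi : R -> R) : Prop :=
  (forall n x, derivable (derive1n n phi) x 1) /\
  (exists a b : R, 0 < a /\ forall x, ~ (a <= x <= b) -> phi x = 0).

Definition weak_derive1 (p g : R -> R) : Prop :=
  locally_integrable pos g /\
  forall phi, test1 phi ->
    \int[mu]_(t in pos) (p t * derive1 phi t) =
    - \int[mu]_(t in pos) (g t * phi t).

Definition dt (phi : R -> R -> R) : R -> R -> R :=
  fun t x => derive1 (phi^~ x) t.

Definition dx (phi : R -> R -> R) : R -> R -> R :=
  fun t x => derive1 (phi t) x.

Fixpoint Cn2 (n : nat) (phi : R -> R -> R) : Prop :=
  continuous (fun z : R * R => phi z.1 z.2) /\
  if n is m.+1 then
    [/\ forall t x, derivable (phi^~ x) t 1, forall t x, derivable (phi t) x 1,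
        Cn2 m (dt phi) & Cn2 m (dx phi)]
  else True.

(* Test functions on (0, oo) x (0, oo). *)
Definition test2 (phi : R -> R -> R) : Prop :=
  (forall n, Cn2 n phi) /\
  (exists a b : R, 0 < a /\
     forall t x, ~ (a <= t <= b /\ a <= x <= b) -> phi t x = 0).

(* w is the distributional derivative of u with respect to the first variable
   on (0, oo) x (0, oo). *)
Definition weak_dt (u w : R -> R -> R) : Prop :=
  forall phi, test2 phi ->
    \int[mu]_(t in pos) (\int[mu]_(x in pos) (u t x * dt phi t x)) =
    - \int[mu]_(t in pos) (\int[mu]_(x in pos) (w t x * phi t x)).

End WeakDerivatives.

Section FunctionSpaces.
Context {R : realType}.
Implicit Types (u w : R -> R -> R).

Let mu := @lebesgue_measure R.
Let mu2 := (mu \x mu)%E.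

Definition L1 (g : R -> R) : Prop := mu.-integrable pos (EFin \o g).

Definition norm1 (g : R -> R) : \bar R := \int[mu]_(x in pos) (`|g x|)%:E.

(* C([0, oo); L^1(0, oo)) *)
Definition continuous_L1 u : Prop :=
  (forall t, 0 <= t -> L1 (u t)) /\
  (forall t0, 0 <= t0 ->
     norm1 (fun x => u t x - u t0 x) @[t --> within [set t | 0 <= t] (nbhs t0)]
       --> 0%E).

(* L^oo((delta, oo); L^oo(0, oo)) *)
Definition Linfty_Linfty (delta : R) u : Prop :=
  exists C : R, {ae mu, forall t, delta < t ->
    {ae mu, forall x, 0 < x -> `|u t x| <= C}}.

(* L^oo_loc((0, oo) x (0, oo)) *)
Definition Linfty_loc w : Prop :=
  measurable_fun (pos `*` pos) (fun z : R * R => w z.1 z.2) /\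
  forall K : set (R * R), compact K -> K `<=` pos `*` pos ->
    exists C : R, {ae mu2, forall z, K z -> `|w z.1 z.2| <= C}.

(* L^1((0, T); L^1(0, oo)), identified with L^1((0, T) x (0, oo)) *)
Definition L1_L1 (T : R) w : Prop :=
  mu2.-integrable (`]0, T[ `*` pos) (fun z => (w z.1 z.2)%:E).

End FunctionSpaces.

Section SolutionPair.
Context {R : realType}.
Implicit Types (theta beta delta : R) (u : R -> R -> R) (pc : R -> R).

Let mu := @lebesgue_measure R.
Let mu2 := (mu \x mu)%E.

Definition theta_norm theta (g : R -> R) : \bar R :=
  (ereal_sup [set (x `^ theta * `|g x|)%:E | x in `]0%R, 1%R[] +
   ereal_sup [set (`|g x|)%:E | x in `]1%R, +oo[])%E.

(* Only x < tau < 1, x < tau with tau > 1, and x > tau are meaningful. At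
   tau = 1 the larger of the two candidate values is taken, and the value
   on the diagonal x = tau is immaterial. *)
Definition lambda_tilde theta beta delta (tau x : R) : R :=
  if tau < x then x `^ (- 1 - beta) * tau `^ (beta - 1)
  else if tau <= 1 then x `^ (- 1 + delta) * tau `^ (- theta - delta)
  else tau ^+ 2.

Definition lambda theta beta delta pc (t x : R) : R :=
  lambda_tilde theta beta delta (\int[mu]_(s in `[0, t]) pc s) x.

(* The bound is stated in \bar R, since the supremum over s is a supremum of
   extended reals. *)
Definition gradient_estimate theta (u0 : R -> R) u pc : Prop :=
  forall beta delta, 0 < beta < 1 -> 0 < delta < 1 ->
  exists C : R, forall t, 0 < t -> {ae mu, forall x, 0 < x ->
    ((`|derive1 (u t) x|)%:E <= C%:E *
      ((lambda theta beta delta pc t x)%:E * (theta_norm theta u0 + norm1 u0) +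
       ereal_sup [set theta_norm theta (u s) + norm1 (u s) | s in `[0%R, t]] *
       \int[mu]_(s in `[0%R, t]) (lambda theta beta delta pc s x)%:E))%E}.

(* The time derivatives of u and pc are the distributional ones: with merely
   a.e. classical derivatives a Cantor function could be added to pc. *)
Record solution_pair (beta0 theta : R) (u0 : R -> R) u pc : Prop := SolutionPair {
  sol_continuous : continuous_L1 u;
  sol_bounded : forall delta, 0 < delta -> Linfty_Linfty delta u;
  sol_pc_continuous : {within `[0, +oo[, continuous pc};
  sol_pc_gt0 : forall t, 0 <= t -> 0 < pc t;
  sol_initial : {ae mu, forall x, 0 < x -> u 0 x = u0 x};
  sol_lipschitz : forall t, 0 < t -> [locally [lipschitz u t x | x in pos]];
  sol_Lu_loc : Linfty_loc (fun t x => L (u t) x);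
  sol_Lu_L1 : forall T, 0 < T -> L1_L1 T (fun t x => L (u t) x);
  sol_dtu : exists w : R -> R -> R,
    [/\ weak_dt u w,
        Linfty_loc w,
        forall T, 0 < T -> L1_L1 T w &
        {ae mu2, forall z : R * R, 0 < z.1 -> 0 < z.2 ->
           w z.1 z.2 = pc z.1 * L (u z.1) z.2}];
  sol_dpc : exists2 g : R -> R, weak_derive1 pc g &
    {ae mu, forall t, 0 < t -> g t = - pc t * moment beta0 4 (L (u t))};
  sol_gradient : gradient_estimate theta u0 u pc }.

End SolutionPair.

(* Main.v *)
Require Import Defs.
From mathcomp Require Import all_boot all_order all_algebra.
From mathcomp Require Import all_classical all_reals all_analysis.
From mathcomp Require Import measurable_realfun ring lra.

(* For a weight a(x) = n0 (1 + n0) x^k, smooth and bounded on (0, oo), testing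
   the equation for u against phi(t) a(x) psi_n(x), with smooth cutoffs psi_n
   tending to 1, shows that the k-th moment of u(t) has the integrable
   function pc(t) * int a L(u(t)) as distributional derivative. For k = 4 this
   cancels the distributional derivative of pc. For k = 6 it vanishes: the
   kernel a(x) M(x, y) is then symmetric in (x, y), so that int a L(g) is half
   the limit of the double integrals of
     (chi_n(x) - chi_n(y)) (g(y) - g(x)) a(x) M(x, y)
   for truncations chi_n, which tend to 0 by dominated convergence when g is
   bounded and locally Lipschitz. The conserved quantities are continuous on
   [0, oo) and have zero distributional derivative, so they are constant
   (du Bois-Reymond). *)

Set Implicit Arguments.
Unset Strict Implicit.
Unset Printing Implicit Defensive.
Import Order.TTheory GRing.Theory Num.Theory.
Import numFieldNormedType.Exports.

Local Open Scope classical_set_scope.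
Local Open Scope ring_scope.

(** * Real-valued integrals *)

Section Integrals.
Context d (T : measurableType d) (R : realType).
Variable mu : {measure set T -> \bar R}.
Implicit Types (D A : set T) (f g h : T -> R).

(** The obstacle for k = 6 is the diagonal, where M(x, y) is of size 1 / (|x - y| (x + y)). Since g
    is Lipschitz only locally, (g(y) - g(x)) a(x) M(x, y) need not be integrable over the whole
    quadrant, and its antisymmetry cannot be used directly. Truncating in x gives integrability,
    with a bound that depends on n; exchanging the variables then produces chi_n(x) - chi_n(y),
    which compensates the singularity in its turn. From there on only the boundedness of g matters,
    and the bound is uniform in n as soon as |chi_n(x) - chi_n(y)| is at most a constant times |x -
    y| / max(x, y). This scale-invariant requirement dictates the shape of [cutoff]. The exponent 6
    comes from the algebra: a(x) M(x, y) contains x^(k-3) y^3 / (sinh x^2 sinh y^2), which is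
    symmetric exactly for k = 6. Test functions must be smooth, so a second truncation, [plateau],
    serves in the weak formulation. No x-derivative falls on the test function there, so pointwise
    convergence and the bound 1 are enough. *)

Lemma integrable_le D f g : measurable D -> measurable_fun D f ->
  (forall x, D x -> `|f x| <= g x) -> mu.-integrable D (EFin \o g) ->
  mu.-integrable D (EFin \o f).
Proof.
move=> mD mf fg; apply: le_integrable => //; first exact/measurable_EFinP.
move=> x Dx; rewrite /= lee_fin (le_trans (fg x Dx))//.
exact: ler_norm.
Qed.

Lemma integrable_mulr D f h (C : R) : measurable D ->
  measurable_fun D h -> (forall x, D x -> `|h x| <= C) ->
  mu.-integrable D (EFin \o f) -> mu.-integrable D (EFin \o (f \* h)).
Proof.
move=> mD mh hC fi; apply: (@integrable_le _ _ (fun x => C * `|f x|)) => //.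
- apply: measurable_funM => //; apply/measurable_EFinP.
  exact: measurable_int fi.
- by move=> x Dx; rewrite normrM mulrC ler_wpM2r// hC.
- by have := integrableZl mD C (integrable_abse fi).
Qed.

Lemma integrable_cstM D f (c : R) : measurable D ->
  mu.-integrable D (EFin \o f) -> mu.-integrable D (EFin \o (fun x => c * f x)).
Proof. by move=> mD /(integrableZl mD c); exact: eq_integrable. Qed.

Lemma integrable_extend A D f : measurable A -> measurable D -> A `<=` D ->
  (forall x, D x -> ~ A x -> f x = 0) -> mu.-integrable A (EFin \o f) ->
  mu.-integrable D (EFin \o f).
Proof.
move=> mA mD AD f0 fi.
have : mu.-integrable D ((EFin \o f) \_ A).
  by apply/integrable_restrict => //; rewrite setIidr.
apply: eq_integrable => // x /set_mem Dx; rewrite patchE.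
by case: ifPn => //; rewrite notin_setE => Ax; rewrite /= f0.
Qed.

Lemma ae_eq_Rintegral D f g : measurable D ->
  measurable_fun D f -> measurable_fun D g ->
  {ae mu, forall x, D x -> f x = g x} ->
  \int[mu]_(x in D) f x = \int[mu]_(x in D) g x.
Proof.
move=> mD mf mg fg; congr fine; apply: ae_eq_integral => //.
- exact/measurable_EFinP.
- exact/measurable_EFinP.
- by apply: filterS fg => x fg Dx; rewrite fg.
Qed.

Lemma dominated_Rintegral D (f_ : nat -> T -> R) f g : measurable D ->
  (forall n, measurable_fun D (f_ n)) ->
  (forall x, D x -> f_ ^~ x @ \oo --> f x) ->
  (forall n x, D x -> `|f_ n x| <= g x) ->
  mu.-integrable D (EFin \o g) ->
  mu.-integrable D (EFin \o f) /\
  \int[mu]_(x in D) f_ n x @[n --> \oo] --> \int[mu]_(x in D) f x.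
Proof.
move=> mD mf_ f_f f_g gi.
have [|||||fi _ fcvg] := @dominated_convergence _ _ _ mu D mD
  (fun n => EFin \o f_ n) (EFin \o f) (EFin \o g).
- by move=> n; apply/measurable_EFinP.
- apply/measurable_EFinP; exact: (measurable_fun_cvg mf_).
- by apply: nearW => x Dx; apply: cvg_EFin; [exact: nearW|exact: f_f].
- by [].
- by apply: nearW => x n Dx; rewrite /= lee_fin f_g.
split => //; apply: fine_cvg; rewrite fineK//.
exact: integrable_fin_num.
Qed.

End Integrals.

(** * Fubini's theorem on a rectangle, for real-valued integrals *)

Section Fubini.
Context d1 d2 (T1 : measurableType d1) (T2 : measurableType d2) (R : realType).
Variables (m1 : {sigma_finite_measure set T1 -> \bar R}).
Variables (m2 : {sigma_finite_measure set T2 -> \bar R}).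
Variables (A : set T1) (B : set T2) (F : T1 * T2 -> R).
Hypotheses (mA : measurable A) (mB : measurable B).
Hypothesis Fi : (m1 \x m2)%E.-integrable (A `*` B) (EFin \o F).

Let mAB : measurable (A `*` B). Proof. exact: measurableX. Qed.

(** Extending [F] by zero reduces integrals over the rectangle to integrals over the whole
    product. *)
Let G : T1 * T2 -> \bar R := (EFin \o F) \_ (A `*` B).

Let Gi : (m1 \x m2)%E.-integrable setT G.
Proof. exact: (integrable_mkcond (EFin \o F) mAB).1. Qed.

Let GA x : A x -> (fun y => G (x, y)) = ((fun y => (F (x, y))%:E) \_ B).
Proof.
move=> Ax; apply/funext => y; rewrite /G !patchE.
by congr (if _ then _ else _); rewrite in_setX (mem_set Ax).
Qed.

Let GnA x : ~ A x -> (fun y => G (x, y)) = cst 0%E.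
Proof.
move=> Ax; apply/funext => y; rewrite /G !patchE.
by case: ifPn => //; rewrite inE => -[].
Qed.

Let GB y : B y -> (fun x => G (x, y)) = ((fun x => (F (x, y))%:E) \_ A).
Proof.
move=> By; apply/funext => x; rewrite /G !patchE.
by congr (if _ then _ else _); rewrite in_setX (mem_set By) andbT.
Qed.

Let GnB y : ~ B y -> (fun x => G (x, y)) = cst 0%E.
Proof.
move=> By; apply/funext => x; rewrite /G !patchE.
by case: ifPn => //; rewrite inE => -[].
Qed.

Lemma ae_integrable_fst :
  {ae m1, forall x, A x -> m2.-integrable B (fun y => (F (x, y))%:E)}.
Proof.
apply: filterS (ae_integrable1 Gi) => x + Ax.
by rewrite GA// => /((integrable_mkcond _ mB).2).
Qed.

Let I1 : T1 -> \bar R := fubini_F m2 G.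

Let I1E x : A x -> I1 x = (\int[m2]_(y in B) (F (x, y))%:E)%E.
Proof. by move=> Ax; rewrite /I1 /fubini_F GA// -integral_mkcond. Qed.

Let I2 : T2 -> \bar R := fubini_G m1 G.

Let I2E y : B y -> I2 y = (\int[m1]_(x in A) (F (x, y))%:E)%E.
Proof. by move=> By; rewrite /I2 /fubini_G GB// -integral_mkcond. Qed.

Let I1i : m1.-integrable setT I1. Proof. exact: (integrable_fubini_F Gi). Qed.

(** By Tonelli, the integral of the modulus of [I2] is at most the double integral of the modulus of
    [G], which is finite. *)
Let I2i : m2.-integrable setT I2.
Proof.
apply/integrableP; split; first exact: (measurable_fubini_G Gi).
have /integrableP[mG] := Gi.
apply: le_lt_trans.
rewrite fubini_tonelli2//; last exact: measurableT_comp.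
apply: ge0_le_integral => //.
- by apply: measurableT_comp => //; exact: (measurable_fubini_G Gi).
- apply: (measurable_fun_fubini_tonelli_G (abse \o G)) => //=.
  exact: measurableT_comp.
- move=> y _; apply: le_abse_integral => //.
  exact: measurableT_comp.
Qed.

(** The inner extended integral may be infinite on a null set; [fine] sends those values to 0, so
    the real inner integral is still dominated by the modulus of [I1]. *)
Lemma integrable_Rintegral_fst :
  m1.-integrable A (EFin \o (fun x => \int[m2]_(y in B) F (x, y))).
Proof.
apply: (@integrable_le _ _ _ m1 A _ (fine \o (abse \o I1))) => //.
- apply: (@eq_measurable_fun _ _ _ _ _ (fine \o I1)).
    by move=> x /set_mem Ax; rewrite /= I1E.
  apply: (@measurable_funTS _ _ _ _ _ (fine \o I1)).
  by apply: measurableT_comp => //; exact: (measurable_fubini_F Gi).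
- move=> x Ax; rewrite /Rintegral /= -I1E//.
  by case: (I1 x) => //=; rewrite normr0.
- have : m1.-integrable A (fun x => `|I1 x|%E).
    apply: integrable_abse; exact: integrableS I1i.
  apply: le_integrable => //.
    apply/measurable_EFinP; apply: (@measurable_funTS _ _ _ _ _ (fine \o (abse \o I1))).
    apply: measurableT_comp => //; apply: measurableT_comp => //.
    exact: (measurable_fubini_F Gi).
  move=> x Ax /=.
  by case: (I1 x) => [r||] /=; rewrite ?normr_id ?normr0 ?leey.
Qed.

Lemma Rintegral_prod_fst :
  \int[(m1 \x m2)%E]_(z in A `*` B) F z =
  \int[m1]_(x in A) \int[m2]_(y in B) F (x, y).
Proof.
rewrite /Rintegral integral_mkcond -/G -integral12_prod_meas1//.
have -> : (\int[m1]_x fubini_F m2 G x = \int[m1]_(x in A) I1 x)%E.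
  rewrite [RHS]integral_mkcond; apply: eq_integral => x _; rewrite patchE.
  case: ifPn => //; rewrite notin_setE => Ax.
  by rewrite /fubini_F GnA// integral_cst// mul0e.
congr fine; apply: ae_eq_integral => //.
- by apply: measurable_funTS; exact: (measurable_fubini_F Gi).
- exact: measurable_int integrable_Rintegral_fst.
- have := integrable_ae measurableT I1i; apply: filterS => x /(_ I) fx Ax.
  by rewrite -I1E// fineK.
Qed.

Lemma Rintegral_prod_snd :
  \int[(m1 \x m2)%E]_(z in A `*` B) F z =
  \int[m2]_(y in B) \int[m1]_(x in A) F (x, y).
Proof.
rewrite /Rintegral integral_mkcond -/G -integral21_prod_meas1//.
have -> : (\int[m2]_y fubini_G m1 G y = \int[m2]_(y in B) I2 y)%E.
  rewrite [RHS]integral_mkcond; apply: eq_integral => y _; rewrite patchE.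
  case: ifPn => //; rewrite notin_setE => By.
  by rewrite /fubini_G GnB// integral_cst// mul0e.
congr fine; apply: ae_eq_integral => //.
- by apply: measurable_funTS; exact: (measurable_fubini_G Gi).
- apply/measurable_EFinP; apply: (@eq_measurable_fun _ _ _ _ _ (fine \o I2)).
    by move=> y /set_mem By; rewrite /= I2E.
  apply: (@measurable_funTS _ _ _ _ _ (fine \o I2)).
  by apply: measurableT_comp => //; exact: (measurable_fubini_G Gi).
- have := integrable_ae measurableT I2i; apply: filterS => y /(_ I) fy By.
  by rewrite -I2E// fineK.
Qed.

End Fubini.

(** * Smooth functions on the line *)

Section Smooth.
Context {R : realType}.
Implicit Types (U V : set R) (f g : R -> R).

(** Each derivative is an existential witness constrained only on [U]. Closure under products and
    composition then follows by induction without any formula for higher derivatives, and functions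
    singular outside [U], such as inverses, are covered. *)
Fixpoint diffn (n : nat) U f : Prop :=
  if n is m.+1 then
    exists2 df, forall x, U x -> is_derive x 1 f (df x) & diffn m U df
  else True.

Lemma diffnS n U f : diffn n.+1 U f -> diffn n U f.
Proof.
elim: n f => [//|n IHn] f [df fdf ndf].
by exists df => //; exact: IHn.
Qed.

Lemma diffn_sub n U V f : V `<=` U -> diffn n U f -> diffn n V f.
Proof.
move=> VU; elim: n f => [//|n IHn] f [df fdf ndf].
by exists df; [move=> x /VU; exact: fdf|exact: IHn].
Qed.

Lemma diffn_cst n U c : diffn n U (cst c).
Proof.
elim: n c => [//|n IHn] c.
by exists (cst 0); [move=> x _; exact: is_derive_cst|exact: IHn].
Qed.

Lemma diffn_id n U : diffn n U id.
Proof.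
case: n => [//|n]; exists (cst 1); last exact: diffn_cst.
by move=> x _; exact: is_derive_id.
Qed.

Lemma diffnD n U f g : diffn n U f -> diffn n U g -> diffn n U (f \+ g).
Proof.
elim: n f g => [//|n IHn] f g [df fdf ndf] [dg gdg ndg].
exists (df \+ dg); last exact: IHn.
by move=> x Ux; apply: is_deriveD; [exact: fdf|exact: gdg].
Qed.

Lemma diffnM n U f g : diffn n U f -> diffn n U g -> diffn n U (f \* g).
Proof.
elim: n f g => [//|n IHn] f g /[dup] /diffnS nf [df fdf ndf].
move=> /[dup] /diffnS ng [dg gdg ndg].
exists ((f \* dg) \+ (g \* df)).
  by move=> x Ux; apply: is_deriveM; [exact: fdf|exact: gdg].
by apply: diffnD; exact: IHn.
Qed.

Lemma diffnX n U k : diffn n U (fun x => x ^+ k).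
Proof.
elim: k => [|k IHk].
  by rewrite (_ : (fun _ => _) = cst 1)//; exact: diffn_cst.
rewrite (_ : (fun _ => _) = (id \* (fun x => x ^+ k))).
  by apply: diffnM => //; exact: diffn_id.
by apply/funext => x; rewrite exprS.
Qed.

Lemma diffn_comp n U V f g : (forall x, U x -> V (g x)) ->
  diffn n V f -> diffn n U g -> diffn n U (f \o g).
Proof.
move=> UV; elim: n f => [//|n IHn] f [df fdf ndf].
move=> /[dup] /diffnS ng [dg gdg ndg].
exists ((df \o g) \* dg); last by apply: diffnM => //; exact: IHn.
by move=> x Ux; apply: is_derive1_comp; [exact: fdf (UV _ Ux)|exact: gdg].
Qed.

Lemma diffnV n : diffn n [set x : R | x != 0] (fun x => x^-1).
Proof.
elim: n => [//|n IHn].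
exists (cst (-1) \* ((fun x => x^-1) \* (fun x => x^-1))).
  move=> x /= x0.
  have := @is_deriveV _ id x 1 1 x0 (is_derive_id x 1).
  move=> /is_derive_eq; apply.
  by rewrite -invfM -expr2 /= mulN1r scaleNr /GRing.scale/= mulr1.
by apply: diffnM; [exact: diffn_cst|exact: diffnM].
Qed.

Lemma diffn_expR n U : diffn n U expR.
Proof. by elim: n => [//|n IHn]; exists expR => // x _; exact: is_derive_expR. Qed.

Lemma eq_diffn n U f g : open U -> (forall x, U x -> f x = g x) ->
  diffn n U f -> diffn n U g.
Proof.
move=> oU fg; case: n => [//|n] [df fdf ndf]; exists df => // x Ux.
apply: near_eq_is_derive (fdf x Ux).
by apply: filterS (open_nbhs_nbhs (conj oU Ux)) => y /fg.
Qed.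

(** The local witnesses may be different functions, but on its own open set each agrees with
    [derive1 f], which therefore serves as a global witness. *)
Lemma diffn_local n f : (forall x, exists U, [/\ open U, U x & diffn n U f]) ->
  diffn n setT f.
Proof.
elim: n f => [//|n IHn] f fU; exists (derive1 f).
  move=> x _; have [U [oU Ux [df /(_ x Ux) fdf _]]] := fU x.
  rewrite derive1E; exact: derivableP.
apply: IHn => x; have [U [oU Ux [df fdf ndf]]] := fU x.
exists U; split => //; apply: eq_diffn ndf => // y /fdf yd.
by rewrite derive1E; have [_ ->] := yd.
Qed.

Definition smooth f := forall n, diffn n setT f.

Lemma smooth_derivable f : smooth f -> forall x, derivable f x 1.
Proof. by move=> /(_ 1%N) [df fdf _] x; have [] := fdf x I. Qed.

Lemma smooth_derive1 f : smooth f -> smooth (derive1 f).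
Proof.
move=> sf n; have [df fdf] := sf n.+1.
congr diffn; apply/funext => x.
by rewrite derive1E; have [_ ->] := fdf x I.
Qed.

Lemma smooth_continuous f : smooth f -> continuous f.
Proof.
move=> sf x; apply: differentiable_continuous; apply/derivable1_diffP.
exact: smooth_derivable.
Qed.

Lemma smoothP f : smooth f <-> forall n x, derivable (derive1n n f) x 1.
Proof.
split=> [sf n x|df n].
  apply: smooth_derivable; elim: n => [//|n IHn].
  by rewrite derive1nS; exact: smooth_derive1.
(* The induction needs all iterated derivatives at once, since one step passes from [derive1n m f]
   to [derive1n m.+1 f]. *)
have : forall m, diffn n setT (derive1n m f).
  elim: n => [//|n IHn] m; exists (derive1n m.+1 f) => // x _.
  by rewrite derive1nS derive1E; exact: derivableP.
by move=> /(_ 0%N).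
Qed.

(* The derivatives of [exp (- 1 / x)] are combinations of the functions
   [x ^ - m * exp (- 1 / x)], all of which vanish to infinite order at [0]. *)
Definition flat (m : nat) (x : R) : R :=
  if 0 < x then x^-1 ^+ m * expR (- x^-1) else 0.

Lemma flat_le0 m x : x <= 0 -> flat m x = 0.
Proof. by rewrite /flat ltNge => ->. Qed.

Lemma flatS m x : flat m x = x * flat m.+1 x.
Proof.
rewrite /flat; case: ifPn => x0; last by rewrite mulr0.
by rewrite exprS -mulrA mulVKf// gt_eqF.
Qed.

(** With y = 1/x, the inequality exp y >= y^(m+1) / (m+1)! gives y^m exp(-y) <= (m+1)! / y, which is
    (m+1)! x. *)
Lemma flat_bound m x : `|flat m x| <= m.+1`!%:R * `|x|.
Proof.
rewrite /flat; case: ifPn => x0; last by rewrite normr0 mulr_ge0.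
have y0 : 0 < x^-1 by rewrite invr_gt0.
rewrite ger0_norm; last by rewrite mulr_ge0 ?expR_ge0 ?exprn_ge0// ltW.
rewrite expRN (gtr0_norm x0) ler_pdivrMr ?expR_gt0//.
have f0 : 0 < m.+1`!%:R :> R by rewrite ltr0n fact_gt0.
have -> : x^-1 ^+ m = m.+1`!%:R * x * (x^-1 ^+ m.+1 / m.+1`!%:R).
  rewrite exprS; move: (x^-1 ^+ m) (m.+1`!%:R : R) f0 => p F F0.
  by field; rewrite !gt_eqF.
rewrite ler_pM2l ?mulr_gt0//; apply: le_trans (expR_ge1Dxn m (ltW y0)).
by rewrite lerDr.
Qed.

Lemma flat_continuous0 m : {for 0, continuous (flat m)}.
Proof.
rewrite /prop_for /continuous_at [X in _ --> X]flat_le0//.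
apply/cvgr0Pnorm_lt => e e0.
have f0 : 0 < m.+1`!%:R :> R by rewrite ltr0n fact_gt0.
near=> x; apply: le_lt_trans (flat_bound m x) _.
rewrite mulrC -ltr_pdivlMr//; near: x.
by apply: cvgr0_norm_lt => //; rewrite divr_gt0.
Unshelve. all: by end_near. Qed.

Lemma is_derive_flat m (x : R) :
  is_derive x (1 : R) (flat m) (flat m.+2 x - m%:R * flat m.+1 x).
Proof.
have [x0|x0|->] := ltgtP x 0.
- rewrite !(flat_le0 _ (ltW x0)) mulr0 subrr.
  apply: (@near_eq_is_derive _ _ _ (cst 0)).
  by near=> y; rewrite flat_le0//; apply/ltW; near: y; exact: lt_nbhsl.
- have Dinv : is_derive x 1 (fun y : R => y^-1) (- (x^-1 ^+ 2)).
    apply: is_derive_eq (@is_deriveV _ id x 1 1 _ _) _; first by rewrite gt_eqF.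
    by rewrite scaleNr /GRing.scale/= mulr1 exprVn.
  have Dm := is_deriveM (is_deriveX m Dinv)
    (is_derive1_comp (is_derive_expR _) (is_deriveN Dinv)).
  apply: near_eq_is_derive (is_derive_eq Dm _).
    near=> y; rewrite /flat ifT; last by near: y; exact: lt_nbhsr.
    by rewrite !fctE.
  rewrite /flat x0 /GRing.scale/= !fctE.
  by case: (m) => [|k] /=; rewrite ?exprS; ring.
(* By [flatS], the difference quotient of [flat m] at 0 is [flat m.+1], which is continuous at 0
   with value 0. *)
- rewrite !flat_le0// mulr0 subrr; apply/is_derive1_caratheodory.
  exists (flat m.+1); split; last by rewrite flat_le0.
    by move=> z; rewrite (flat_le0 _ (lexx 0)) !subr0 mulrC -flatS.
  exact: flat_continuous0.
Unshelve. all: by end_near. Qed.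

Lemma smooth_flat m : smooth (flat m).
Proof.
move=> n; elim: n m => [//|n IHn] m.
exists (flat m.+2 \+ (cst (- m%:R) \* flat m.+1)).
  by move=> x _; apply: is_derive_eq (is_derive_flat m x) _; rewrite /= mulNr.
apply: diffnD => //; apply: diffnM => //; exact: diffn_cst.
Qed.

Lemma flat0_itv x : 0 <= flat 0 x <= 1.
Proof.
rewrite /flat; case: ifPn => x0; last by rewrite lexx ler01.
rewrite mul1r expR_ge0 -expR0 ler_expR oppr_le0 invr_ge0 ltW//.
Qed.

Lemma flat0_gt0 x : 0 < x -> 0 < flat 0 x.
Proof. by move=> x0; rewrite /flat x0 mul1r expR_gt0. Qed.

End Smooth.

(** * The du Bois-Reymond lemma *)

Section Mollifier.
Context {R : realType}.
Local Notation mu := (@lebesgue_measure R).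
Implicit Types (f phi : R -> R).

Lemma measurable_pos : measurable (@pos R : set (measurableTypeR R)).
Proof. exact: measurable_itv. Qed.

Lemma open_pos : open (@pos R).
Proof. exact: interval_open. Qed.

Lemma posE (x : R) : pos x = (0 < x) :> Prop.
Proof. by rewrite /pos /= in_itv /= andbT. Qed.

Lemma integrable_itv_supp (f : R -> R) (D : set R) a b :
  measurable D -> `[a, b] `<=` D -> {in `[a, b], continuous f} ->
  (forall x, D x -> ~ (a <= x <= b) -> f x = 0) -> mu.-integrable D (EFin \o f).
Proof.
move=> mD abD cf f0.
apply: (@integrable_extend _ (measurableTypeR R) R mu `[a, b] D f) => //.
apply: continuous_compact_integrable; first exact: segment_compact.
by apply: continuous_in_subspaceT => x /set_mem; exact: cf.
Qed.

(** If the integral vanished, [f] would be zero almost everywhere, and the interval from [a] to [b],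
    of positive length, would lie in a null set. *)
Lemma integral_pos_eq0 f a b : measurable_fun pos f ->
  (forall x, 0 < x -> 0 <= f x) -> a < b -> 0 <= a ->
  (forall x, a < x < b -> 0 < f x) ->
  mu.-integrable pos (EFin \o f) -> \int[mu]_(x in pos) f x != 0.
Proof.
move=> mf f0 ab a0 fgt0 fi; apply/eqP => If.
have fint0 : (\int[mu]_(x in pos) `|(EFin \o f) x| = 0)%E.
  transitivity (\int[mu]_(x in pos) (f x)%:E)%E.
    apply: eq_integral => x /set_mem; rewrite posE => x0.
    by rewrite /= ger0_norm// f0.
  rewrite -[LHS]fineK; first by rewrite [fine _]If.
  by apply: integrable_fin_num => //; exact: measurable_pos.
have mEf : measurable_fun pos (EFin \o f) by exact/measurable_EFinP.
have [N [mN N0 subN]] :=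
  (@ae_eq_integral_abs _ _ _ mu pos measurable_pos _ mEf).1 fint0.
have : (mu `]a, b[ <= mu N)%E.
  apply: le_measure; rewrite ?inE//.
  move=> x /=; rewrite in_itv/= => /[dup] axb /andP[ax xb]; apply: subN => /=.
  apply/not_implyP; split; first by rewrite posE (le_lt_trans a0).
  by move=> [fx]; have := fgt0 x axb; rewrite fx ltxx.
rewrite [X in (_ <= X)%E](_ : _ = 0%E); last exact: N0.
by rewrite lebesgue_measure_itv/= lte_fin ab -EFinB lee_fin leNgt subr_gt0 ab.
Qed.

(** * A one-sided bump function and its primitive *)

Section FixedWidth.
Variable e : R.
Hypothesis e0 : 0 < e.

(** The quadratic x (e - x) is positive exactly between 0 and e. The bump lies to the right of 0
    rather than around it, so that its translates by s > 0 remain in (0, oo) whatever the width. It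
    is not normalized: only differences of two translates are used. *)
Definition mollifier (x : R) : R := flat 0 (x * (e - x)).

Lemma mollifier_ge0 x : 0 <= mollifier x.
Proof. by rewrite /mollifier; case/andP: (flat0_itv (x * (e - x))). Qed.

Lemma mollifier_gt0 x : 0 < x < e -> 0 < mollifier x.
Proof. by case/andP=> x0 xe; rewrite flat0_gt0// mulr_gt0// subr_gt0. Qed.

Lemma mollifier_eq0 x : ~ (0 < x < e) -> mollifier x = 0.
Proof.
move=> xe; rewrite /mollifier flat_le0//.
have [x0|x0] := leP x 0; first by rewrite mulr_le0_ge0// subr_ge0 (le_trans x0)// ltW.
have [xe'|xe'] := ltP x e; first by case: xe; rewrite x0.
by rewrite mulr_ge0_le0 ?subr_le0// ltW.
Qed.

Lemma smooth_mollifier : smooth mollifier.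
Proof.
move=> n; apply: (@diffn_comp _ _ _ setT) => //; first exact: smooth_flat.
rewrite (_ : (fun _ => _) = id \* (cst e \+ (cst (-1) \* id))).
  apply: diffnM; first exact: diffn_id.
  apply: diffnD; first exact: diffn_cst.
  by apply: diffnM; [exact: diffn_cst|exact: diffn_id].
by apply/funext => x /=; rewrite mulN1r.
Qed.

Lemma integrable_mollifier : mu.-integrable setT (EFin \o mollifier).
Proof.
apply: (@integrable_itv_supp _ _ 0 e) => //.
  by move=> x _; exact: smooth_continuous smooth_mollifier x.
move=> x _ xe; apply: mollifier_eq0; apply: contra_not xe => /andP[x0 xe].
by rewrite !ltW.
Qed.

Definition mollifier_primitive (x : R) : R := \int[mu]_(t in `]-oo, x]) mollifier t.

Lemma is_derive_mollifier_primitive (x : R) :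
  is_derive x (1 : R) mollifier_primitive (mollifier x).
Proof.
have x1 : x < x + 1 by rewrite ltrDl.
have bi : mu.-integrable `]-oo, x + 1] (EFin \o mollifier).
  by apply: integrableS integrable_mollifier.
have cb : {for x, continuous mollifier} by exact: smooth_continuous smooth_mollifier x.
have [|Fx dFx] := continuous_FTC1 x1 bi _ cb; first by rewrite /= ltNyr.
by apply: DeriveDef; [exact: Fx|rewrite -derive1E; exact: dFx].
Qed.

Lemma smooth_mollifier_primitive : smooth mollifier_primitive.
Proof.
case=> [//|n]; exists mollifier; last exact: smooth_mollifier.
by move=> x _; exact: is_derive_mollifier_primitive.
Qed.

Lemma mollifier_primitive_le0 x : x <= 0 -> mollifier_primitive x = 0.
Proof.
move=> x0; rewrite /mollifier_primitive.
rewrite (@eq_Rintegral _ _ _ _ _ (cst 0)) ?Rintegral_cst ?mul0r// => t.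
rewrite inE/= in_itv/= => tx; rewrite mollifier_eq0// => /andP[].
by rewrite ltNge (le_trans tx).
Qed.

Lemma mollifier_primitive_ge x :
  e <= x -> mollifier_primitive x = mollifier_primitive e.
Proof.
move=> ex; have [||c] := @MVT_segment R mollifier_primitive mollifier e x ex.
- by move=> y _; exact: is_derive_mollifier_primitive.
- by apply: continuous_subspaceT; exact: smooth_continuous smooth_mollifier_primitive.
rewrite in_itv/= => /andP[ec _]; rewrite mollifier_eq0 ?mul0r.
  by move/subr0_eq.
by move=> /andP[_]; rewrite ltNge ec.
Qed.

End FixedWidth.

Definition pos_supp (g : R -> R) : Prop :=
  exists a b : R, 0 < a /\ forall x, ~ (a <= x <= b) -> g x = 0.

Lemma test1P phi : test1 phi <-> smooth phi /\ pos_supp phi.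
Proof. by split=> -[/smoothP]. Qed.

Lemma test1_continuous phi : test1 phi -> continuous phi.
Proof. by move=> /test1P[/smooth_continuous]. Qed.

Lemma test1_derive1_continuous phi : test1 phi -> continuous (derive1 phi).
Proof. by move=> /test1P[/smooth_derive1/smooth_continuous]. Qed.

Lemma derive1_pos_supp phi : pos_supp phi -> pos_supp (derive1 phi).
Proof.
move=> [a [b [a0 phi0]]]; exists a, b; split => // x xab.
have : is_derive x (1 : R) phi 0.
  apply: (@near_eq_is_derive _ _ _ (cst 0)).
  have : (~` `[a, b]) x by rewrite /= in_itv.
  have oC : open (~` `[a, b]%classic) by apply/closed_openC/itv_closed.
  move=> /(conj oC) /open_nbhs_nbhs; apply: filterS => y /=.
  by rewrite in_itv/= => /phi0.
by rewrite derive1E => -[_ ->].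
Qed.

Lemma integrable_pos_supp f g : {in pos, continuous f} -> continuous g ->
  pos_supp g -> mu.-integrable pos (EFin \o (f \* g)).
Proof.
move=> cf cg [a [b [a0 g0]]].
apply: (@integrable_itv_supp _ _ a b) => //.
- exact: measurable_pos.
- by move=> x; rewrite /= in_itv/= posE => /andP[/(lt_le_trans a0)].
- move=> x; rewrite in_itv/= => /andP[ax xb].
  apply: continuousM; last exact: cg.
  by apply: cf; rewrite inE posE (lt_le_trans a0).
- by move=> x _ /g0 gx; rewrite /= gx mulr0.
Qed.

Lemma Rintegral_derive1_test1 phi : test1 phi ->
  \int[mu]_(t in pos) derive1 phi t = 0.
Proof.
move=> tphi; have [sphi [a [b [a0 phi0]]]] := (test1P phi).1 tphi.
have [a' [b' [a'0 dphi0]]] := derive1_pos_supp ((test1P phi).1 tphi).2.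
(* The intervals known to contain the supports of [phi] and of its derivative may differ, so [l] is
   chosen below both and [r] above both. The integral then reduces to [phi r - phi l], where both
   terms are zero. *)
pose l := Num.min a a' / 2; pose r := Num.max l (Num.max b b') + 1.
have l0 : 0 < l by rewrite divr_gt0// lt_min a0.
have la : l < Num.min a a' by rewrite ltr_pdivrMr// ltr_pMr ?lt_min ?a0// ltr1n.
have maxr : Num.max l (Num.max b b') < r by rewrite ltrDl.
have lr : l < r by rewrite (le_lt_trans _ maxr)// le_max lexx.
have phil : phi l = 0.
  apply: phi0; move: la; rewrite lt_min => /andP[+ _] /andP[].
  by rewrite ltNge => /negP.
have phir : phi r = 0.
  apply: phi0 => /andP[_]; apply/negP; rewrite -ltNge.
  by rewrite (le_lt_trans _ maxr)// !le_max lexx !orbT.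
transitivity (\int[mu]_(t in `[l, r]) derive1 phi t).
  rewrite [RHS](_ : _ = \int[mu]_(t in pos `&` `[l, r]) derive1 phi t).
    rewrite Rintegral_mkcondr; apply: eq_Rintegral => t _.
    rewrite patchE; case: ifPn => //; rewrite notin_setE /= in_itv/= => tlr.
    apply: dphi0 => /andP[a't tb']; apply: tlr; apply/andP; split.
      by rewrite (le_trans (ltW la))// ge_min a't orbT.
    by rewrite (le_trans tb')// (le_trans _ (ltW maxr))// !le_max lexx !orbT.
  congr (Rintegral _ _ _); rewrite setIidr// => t /=.
  by rewrite in_itv/= posE => /andP[/(lt_le_trans l0)].
rewrite /Rintegral (@continuous_FTC2 _ _ phi _ _ lr) ?phil ?phir ?subee//.
- by apply: continuous_subspaceT; exact: test1_derive1_continuous.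
- split.
  + by move=> x _; exact: smooth_derivable.
  + by apply: cvg_at_right_filter; exact: smooth_continuous.
  + by apply: cvg_at_left_filter; exact: smooth_continuous.
Qed.

(** Each translated primitive is 0 far to the left and equals the total mass of the bump far to the
    right; these values cancel in the difference, which is thus compactly supported. *)
Lemma test1_mollifier_primitiveB e s t : 0 < e -> 0 < s -> 0 < t ->
  let phi := fun x => mollifier_primitive e (x - s) - mollifier_primitive e (x - t) in
  test1 phi /\ forall x, derive1 phi x = mollifier e (x - s) - mollifier e (x - t).
Proof.
move=> e0 s0 t0 phi.
have shift_der (c x : R) : is_derive x (1 : R) (fun y => y - c) 1.
  by apply: is_derive_eq; rewrite subr0.
have smooth_shift c : smooth (fun x => mollifier_primitive e (x - c)).
  move=> n; apply: (@diffn_comp _ _ _ setT) => //.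
    exact: smooth_mollifier_primitive.
  apply: (@diffnD _ n setT id (cst (- c))); [exact: diffn_id|exact: diffn_cst].
split; last first.
  move=> x; rewrite derive1E.
  have D c : is_derive x (1 : R) (fun y => mollifier_primitive e (y - c))
      (mollifier e (x - c)).
    have := @is_derive1_comp R (mollifier_primitive e) (fun y => y - c) x _ _
      (is_derive_mollifier_primitive e0 (x - c)) (shift_der c x).
    by rewrite mulr1.
  by have [_ ->] := is_deriveB (D s) (D t).
apply/test1P; split.
  move=> n; rewrite (_ : phi = (fun x => mollifier_primitive e (x - s)) \+
    (cst (-1) \* (fun x => mollifier_primitive e (x - t)))).
    by apply: diffnD => //; [exact: smooth_shift|apply: diffnM;
      [exact: diffn_cst|exact: smooth_shift]].
  by apply/funext => x; rewrite /phi /= mulN1r.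
exists (Num.min s t), (Num.max s t + e); split; first by rewrite lt_min s0.
move=> x /negP; rewrite negb_and -!ltNge => /orP[|].
  rewrite lt_min => /andP[xs xt]; rewrite /phi.
  by rewrite !mollifier_primitive_le0 ?subrr// subr_le0 ltW.
rewrite -ltrBrDr gt_max => /andP[xs xt]; rewrite /phi.
rewrite (@mollifier_primitive_ge _ e0 (x - s)).
  rewrite (@mollifier_primitive_ge _ e0 (x - t)) ?subrr//.
  by rewrite lerBrDl -lerBrDr ltW.
by rewrite lerBrDl -lerBrDr ltW.
Qed.

(* If [f s < c < f t], the test function whose derivative is a narrow mollifier
   at [s] minus the same one at [t] gives [\int (c - f) phi' > 0]. *)
Lemma du_Bois_Reymond f : {in pos, continuous f} ->
  (forall phi, test1 phi -> \int[mu]_(t in pos) (f t * derive1 phi t) = 0) ->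
  forall s t, 0 < s -> 0 < t -> f s = f t.
Proof.
move=> cf f0.
suff le (s t : R) : 0 < s -> 0 < t -> f s < f t -> False.
  move=> s t s0 t0; apply/eqP/negPn/negP; rewrite neq_lt.
  by case/orP; exact: le.
move=> s0 t0 fst; pose c := (f s + f t) / 2.
have fsc : f s < c by rewrite midf_lt.
have cft : c < f t by rewrite midf_lt.
have /nbhs_ballP[e1 /= e10 He1] : \forall x \near s, f x < c.
  by apply: (@cvgr_lt _ _ (nbhs s) _ f (f s)) => //; apply: cf; rewrite inE posE.
have /nbhs_ballP[e2 /= e20 He2] : \forall x \near t, c < f x.
  by apply: (@cvgr_gt _ _ (nbhs t) _ f (f t)) => //; apply: cf; rewrite inE posE.
pose e := Num.min e1 e2.
have e0 : 0 < e by rewrite lt_min e10.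
have [tphi dphi] := test1_mollifier_primitiveB e0 s0 t0.
set phi := fun x : R => _ in tphi dphi.
have phi_supp := derive1_pos_supp ((test1P phi).1 tphi).2.
have cdphi := test1_derive1_continuous tphi.
have ifphi := integrable_pos_supp cf cdphi phi_supp.
have idphi : mu.-integrable pos (EFin \o derive1 phi).
  have c1 : {in pos, continuous (cst 1 : R -> R)} by move=> x _; exact: cst_continuous.
  apply: eq_integrable (integrable_pos_supp c1 cdphi phi_supp).
    exact: measurable_pos.
  by move=> x _ /=; rewrite mul1r.
have icphi : mu.-integrable pos (fun x => (c * derive1 phi x)%:E).
  by apply: integrable_pos_supp => // x _; exact: cst_continuous.
(* Both parts vanish: a constant times the integral of the derivative of a test function, and the
   hypothesis on [f]. The rest shows that this integrand is a sum of two nonnegative terms, the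
   first positive on an interval. *)
have int0 : \int[mu]_(x in pos) (c * derive1 phi x - f x * derive1 phi x) = 0.
  rewrite RintegralB//; last exact: measurable_pos.
  rewrite f0// RintegralZl ?Rintegral_derive1_test1 ?mulr0 ?subrr//.
  exact: measurable_pos.
have ge0s x : 0 <= (c - f x) * mollifier e (x - s).
  have [xs|/negP xs] := boolP (0 < x - s < e); last by rewrite mollifier_eq0 ?mulr0.
  rewrite mulr_ge0 ?mollifier_ge0// subr_ge0 ltW//; apply: He1.
  rewrite /ball/= distrC; case/andP: xs => xs0 xse.
  by rewrite gtr0_norm// (lt_le_trans xse)// ge_min lexx.
have ge0t x : 0 <= (c - f x) * - mollifier e (x - t).
  have [xs|/negP xs] := boolP (0 < x - t < e).
    rewrite mulrN -mulNr opprB mulr_ge0 ?mollifier_ge0// subr_ge0 ltW//.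
    apply: He2; rewrite /ball/= distrC; case/andP: xs => xs0 xse.
    by rewrite gtr0_norm// (lt_le_trans xse)// ge_min lexx orbT.
  by rewrite mollifier_eq0 ?oppr0 ?mulr0.
have iall : mu.-integrable pos
    (EFin \o (fun x => c * derive1 phi x - f x * derive1 phi x)).
  apply: eq_integrable (integrableB _ icphi ifphi) => //; exact: measurable_pos.
suff : (0 : R) != 0 by rewrite eqxx.
rewrite -[X in X != _]int0; apply: (@integral_pos_eq0 _ s (s + e)) => //.
- by apply/measurable_EFinP; exact: measurable_int iall.
- by move=> x _; rewrite -mulrBl dphi mulrDr addr_ge0.
- by rewrite ltrDl.
- exact: ltW.
- move=> x /andP[sx xse]; rewrite -mulrBl dphi mulrDr ltr_pwDl// mulr_gt0//.
    rewrite subr_gt0; apply: He1; rewrite /ball/= distrC gtr0_norm ?subr_gt0//.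
    by rewrite ltrBlDl (lt_le_trans xse)// lerD2l ge_min lexx.
  by apply: mollifier_gt0; rewrite subr_gt0 sx ltrBlDl.
Qed.

End Mollifier.

(** * The symmetrized kernel *)

Section KernelBounds.
Context {R : realType}.
Local Notation mu := (@lebesgue_measure R).
Implicit Types (x y z : R).

(** The average of exp z >= 1 + z and exp z >= 1 + z^2/2, combined with exp(-z) <= 1, gives z/4 +
    z^2/8. The linear part controls the kernel near the diagonal, the quadratic part gives decay at
    infinity. *)
Lemma sinh_ge z : 0 <= z -> z * (2 + z) / 8 <= sinh z.
Proof.
move=> z0; have e1 := expR_ge1Dx z.
have e2 : 1 + z ^+ 2 / 2 <= expR z := expR_ge1Dxn 1 z0.
have e3 : expR (- z) <= 1 by rewrite -expR0 ler_expR oppr_le0.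
rewrite /sinh; nra.
Qed.

Lemma sinh_ge_quarter z : 0 <= z -> z / 4 <= sinh z.
Proof. by move=> z0; have := sinh_ge z0; nra. Qed.

Lemma sinh_ge_eighth z : 0 <= z -> z * (1 + z) / 8 <= sinh z.
Proof. by move=> z0; have := sinh_ge z0; nra. Qed.

Lemma sinh_gt0 z : 0 < z -> 0 < sinh z.
Proof.
by move=> z0; apply: lt_le_trans (sinh_ge_quarter (ltW z0)); rewrite divr_gt0.
Qed.

Definition weight beta0 (k : nat) x : R :=
  n0 beta0 x * (1 + n0 beta0 x) * x ^+ k.

Lemma weightE beta0 k x : 0 < beta0 -> 0 < x ->
  weight beta0 k x = (4 * sinh (x ^+ 2) ^+ 2)^-1 * x ^+ k.
Proof. by move=> b0 x0; rewrite /weight n0_1n0E// gt_eqF. Qed.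

Lemma weight_gt0 beta0 k x : 0 < beta0 -> 0 < x -> 0 < weight beta0 k x.
Proof.
move=> b0 x0; rewrite weightE// mulr_gt0 ?exprn_gt0// invr_gt0 mulr_gt0//.
by rewrite exprn_gt0// sinh_gt0// exprn_gt0.
Qed.

(** With X = x^2, sinh X >= X (1 + X) / 8 gives 4 sinh^2 X >= X^2 (1 + X)^2 / 16. The weights are
    X^2 and X^3 over 4 sinh^2 X, and both 1 and X are at most (1 + X)^2. *)
Lemma weight_le beta0 x : 0 < beta0 -> 0 < x ->
  weight beta0 4 x <= 16 /\ weight beta0 6 x <= 16.
Proof.
move=> b0 x0; rewrite !weightE//; set X := x ^+ 2.
have X0 : 0 < X by rewrite exprn_gt0.
have S0 : 0 < sinh X := sinh_gt0 X0.
have S8 := sinh_ge_eighth (ltW X0).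
have SX : (X * (1 + X) / 8) ^+ 2 <= sinh X ^+ 2.
  by rewrite ler_sqr ?nnegrE ?(ltW S0)// divr_ge0// mulr_ge0 ?addr_ge0// ltW.
have -> : x ^+ 4 = X ^+ 2 by rewrite -exprM.
have -> : x ^+ 6 = X ^+ 3 by rewrite -exprM.
have S4 : 0 < 4 * sinh X ^+ 2 by rewrite mulr_gt0// exprn_gt0.
have S64 : X ^+ 2 * (1 + X) ^+ 2 <= 64 * sinh X ^+ 2.
  have -> : X ^+ 2 * (1 + X) ^+ 2 = 64 * (X * (1 + X) / 8) ^+ 2 by field.
  by rewrite ler_pM2l.
have X1 : 1 <= (1 + X) ^+ 2 by nra.
have X2 : X <= (1 + X) ^+ 2 by nra.
split; rewrite mulrC ler_pdivrMr// mulrA -natrM.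
  by apply: le_trans S64; rewrite ler_peMr// exprn_ge0// (ltW X0).
by apply: le_trans S64; rewrite exprSr ler_wpM2l// exprn_ge0// (ltW X0).
Qed.

Lemma diffn_weight beta0 k n : 0 < beta0 -> diffn n pos (weight beta0 k).
Proof.
move=> b0.
have Dsq : diffn n pos (fun x : R => x ^+ 2) by exact: diffnX.
have De : diffn n pos (fun x => expR (x ^+ 2)).
  by apply: (@diffn_comp _ n pos setT expR) => //; exact: diffn_expR.
have DeN : diffn n pos (fun x => expR (- x ^+ 2)).
  apply: (@diffn_comp _ n pos setT expR (fun x => - x ^+ 2)) => //.
    exact: diffn_expR.
  rewrite (_ : (fun _ => _) = cst (-1) \* (fun x : R => x ^+ 2)).
    by apply: diffnM => //; exact: diffn_cst.
  by apply/funext => x; rewrite /= mulN1r.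
have Dsinh : diffn n pos (fun x => sinh (x ^+ 2)).
  rewrite (_ : (fun _ => _) = ((fun x => expR (x ^+ 2)) \+
    (cst (-1) \* (fun x => expR (- x ^+ 2)))) \* cst 2^-1).
    apply: diffnM; last exact: diffn_cst.
    by apply: diffnD => //; apply: diffnM => //; exact: diffn_cst.
  by apply/funext => x; rewrite /sinh /= mulN1r.
apply: (@eq_diffn _ _ _ ((fun x => (4 * (sinh (x ^+ 2) * sinh (x ^+ 2)))^-1) \*
  (fun x => x ^+ k))); first exact: open_pos.
  by move=> x; rewrite posE => x0; rewrite weightE.
apply: diffnM; last exact: diffnX.
apply: (@diffn_comp _ n pos [set x : R | x != 0] (fun x => x^-1)
  (fun x => 4 * (sinh (x ^+ 2) * sinh (x ^+ 2)))).
- move=> x; rewrite posE => x0 /=; rewrite gt_eqF// mulr_gt0//.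
  by rewrite mulr_gt0// sinh_gt0// exprn_gt0.
- exact: diffnV.
- apply: diffnM; first exact: diffn_cst.
  exact: diffnM.
Qed.

Lemma measurable_weight beta0 k : 0 < beta0 -> measurable_fun pos (weight beta0 k).
Proof.
move=> b0; apply: open_continuous_measurable_fun; first exact: open_pos.
move=> x /set_mem x0; have [df /(_ _ x0)] := diffn_weight k 1 b0.
by move=> [/derivable1_diffP/differentiable_continuous].
Qed.

(** For positive arguments this is [weight beta0 6 x * M x y] (see [weight_M]): the weight turns the
    factor sinh(x^2) / x^3 of [M] into x^3 / (4 sinh(x^2)), the counterpart of y^3 / sinh(y^2). *)
Definition symM x y : R :=
  ((sinh `|x ^+ 2 - y ^+ 2|)^-1 - (sinh (x ^+ 2 + y ^+ 2))^-1) *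
  (x ^+ 3 * y ^+ 3 / (4 * sinh (x ^+ 2) * sinh (y ^+ 2))).

Lemma symMC x y : symM x y = symM y x.
Proof.
rewrite /symM distrC; congr (_ * (_ / _)); try ring.
by rewrite [x ^+ 2 + _]addrC.
Qed.

Lemma weight_M beta0 x y : 0 < beta0 -> 0 < x -> 0 < y ->
  weight beta0 6 x * M x y = symM x y.
Proof.
move=> b0 x0 y0; rewrite weightE// /M /symM.
have sx : sinh (x ^+ 2) != 0 by rewrite gt_eqF// sinh_gt0// exprn_gt0.
have sy : sinh (y ^+ 2) != 0 by rewrite gt_eqF// sinh_gt0// exprn_gt0.
move: (_ - _) (sinh (x ^+ 2)) (sinh (y ^+ 2)) sx sy => K X Y X0 Y0.
by field; rewrite X0 Y0 gt_eqF.
Qed.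

(** Both inverses in the first factor are at most 4 / |x^2 - y^2|, so that factor is at most 8 / (|x
    - y| (x + y)). By sinh z >= z (1 + z) / 8 the second factor is at most 16 x y / ((1 + x^2)(1 +
    y^2)). Hence 128 = 8 * 16; the remaining profile 1 / (1 + x^2) is integrable. *)
Lemma symM_bound x y : 0 < x -> 0 < y ->
  `|x - y| * `|symM x y| <=
  128 * (x * y / (x + y)) * ((1 + x ^+ 2)^-1 * (1 + y ^+ 2)^-1).
Proof.
move=> x0 y0.
have [->|xy] := eqVneq x y.
  rewrite subrr normr0 mul0r !mulr_ge0 ?invr_ge0 ?addr_ge0 ?exprn_ge0//; exact/ltW.
have d0 : 0 < `|x - y| by rewrite normr_gt0 subr_eq0.
have s0 : 0 < x + y by rewrite addr_gt0.
have x20 : 0 < x ^+ 2 by rewrite exprn_gt0.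
have y20 : 0 < y ^+ 2 by rewrite exprn_gt0.
have dE : `|x ^+ 2 - y ^+ 2| = `|x - y| * (x + y).
  by rewrite subr_sqr normrM (gtr0_norm s0).
have D0 : 0 < `|x ^+ 2 - y ^+ 2| by rewrite dE mulr_gt0.
have Dle : `|x ^+ 2 - y ^+ 2| <= x ^+ 2 + y ^+ 2.
  by rewrite ler_norml; apply/andP; split; lra.
have inv_sinh z : 0 < z -> 0 < (sinh z)^-1 <= 4 / z.
  move=> z0; rewrite invr_gt0 sinh_gt0//= -[4 / z]invf_div lef_pV2.
  - exact/sinh_ge_quarter/ltW.
  - by rewrite posrE sinh_gt0.
  - by rewrite posrE divr_gt0.
have inv_sinh8 z : 0 < z -> 0 < (sinh z)^-1 <= 8 / (z * (1 + z)).
  move=> z0; rewrite invr_gt0 sinh_gt0//= -[8 / _]invf_div lef_pV2.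
  - exact/sinh_ge_eighth/ltW.
  - by rewrite posrE sinh_gt0.
  - by rewrite posrE divr_gt0// mulr_gt0// addr_gt0.
rewrite /symM normrM.
set K := (sinh _)^-1 - _; set P := _ / (4 * _ * _).
have K8 : `|K| <= 8 / `|x ^+ 2 - y ^+ 2|.
  rewrite /K; have /andP[a0 a1] := inv_sinh _ D0.
  have /andP[b0 b1] := inv_sinh _ (addr_gt0 x20 y20).
  have : 4 / (x ^+ 2 + y ^+ 2) <= 4 / `|x ^+ 2 - y ^+ 2|.
    by rewrite ler_pM2l// lef_pV2// posrE addr_gt0.
  have -> : 8 / `|x ^+ 2 - y ^+ 2| = 4 / `|x ^+ 2 - y ^+ 2| + 4 / `|x ^+ 2 - y ^+ 2|.
    by rewrite -mulrDl; congr (_ / _); lra.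
  by rewrite ler_norml; move=> b2; apply/andP; split; lra.
have /andP[a0 a1] := inv_sinh8 _ x20.
have /andP[b0 b1] := inv_sinh8 _ y20.
have P16 : `|P| <= 16 * (x * y) * ((1 + x ^+ 2)^-1 * (1 + y ^+ 2)^-1).
  have -> : P = x ^+ 3 * y ^+ 3 / 4 * ((sinh (x ^+ 2))^-1 * (sinh (y ^+ 2))^-1).
    by rewrite /P !invfM; ring.
  have c0 : 0 < x ^+ 3 * y ^+ 3 / 4 by rewrite divr_gt0// mulr_gt0// exprn_gt0.
  rewrite gtr0_norm ?mulr_gt0//.
  apply: (@le_trans _ _ (x ^+ 3 * y ^+ 3 / 4 *
    (8 / (x ^+ 2 * (1 + x ^+ 2)) * (8 / (y ^+ 2 * (1 + y ^+ 2)))))).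
    by rewrite ler_pM2l// ler_pM// ltW.
  rewrite le_eqVlt; apply/orP; left; apply/eqP; field.
  by rewrite !gt_eqF// ?addr_gt0.
apply: (@le_trans _ _ (`|x - y| * (8 / `|x ^+ 2 - y ^+ 2| *
  (16 * (x * y) * ((1 + x ^+ 2)^-1 * (1 + y ^+ 2)^-1))))).
  by rewrite ler_pM2l// ler_pM.
rewrite dE le_eqVlt; apply/orP; left; apply/eqP; field.
by rewrite !gt_eqF// addr_gt0.
Qed.

Lemma integrable_oneDsqrV :
  mu.-integrable pos (EFin \o (fun x => (1 + x ^+ 2)^-1)).
Proof.
have mpos := @measurable_pos R.
have q0 x : 0 <= (1 + x ^+ 2)^-1 by rewrite invr_ge0 addr_ge0// sqr_ge0.
have mq : measurable_fun setT (fun x : R => (1 + x ^+ 2)^-1).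
  by apply: continuous_measurable_fun; exact: continuous_oneDsqrV.
apply/integrableP; split.
  by apply/measurable_EFinP; exact: measurable_funTS.
apply: (@le_lt_trans _ _ (\int[mu]_(x in `[0%R, +oo[) (oneDsqr x)^-1%:E)%E).
  under eq_integral do rewrite /= ger0_norm//.
  apply: ge0_subset_integral => //.
  - by apply/measurable_EFinP; exact: measurable_funTS.
  - by move=> x _; rewrite lee_fin q0.
  - by move=> x; rewrite posE /= in_itv/= andbT; exact: ltW.
by rewrite integral0y_oneDsqr ltry.
Qed.

End KernelBounds.

(** * A truncation that varies slowly at every scale *)

Section Cutoff.
Context {R : realType}.
Implicit Types (x y k : R).

Lemma measurable_invr : measurable_fun [set: R] (fun x : R => x^-1).
Proof.
have -> : [set: R] = [set 0] `|` [set x : R | x != 0].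
  by apply/seteqP; split => // x _ /=; case: (eqVneq x 0); [left|right].
have o0 : open [set x : R | x != 0] by exact: open_neq.
apply/measurable_funU => //; first exact: open_measurable.
split; first exact: measurable_fun_set1.
apply: open_continuous_measurable_fun => // x /set_mem/= x0.
exact: inv_continuous.
Qed.

(* A cutoff of [[1/k, k]] which, by [cutoff_lipschitz], varies slowly at the
   scale of its argument, uniformly in [k]: this compensates the singularity of
   the kernel on the diagonal by a bound independent of [k]. *)
Definition cutoff k x : R :=
  Num.max 0 (1 - Num.min 1 (k * x)^-1 - Num.min 1 (x / k)).

Lemma measurable_cutoff k : measurable_fun setT (cutoff k).
Proof.
apply: measurable_maxr => //; apply: measurable_funB.
  apply: measurable_funB => //; apply: measurable_minr => //.
  apply: (measurableT_comp measurable_invr).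
  exact: mulrl_measurable.
by apply: measurable_minr => //; exact: mulrr_measurable.
Qed.

Lemma cutoff_itv k x : 0 < k -> 0 < x -> 0 <= cutoff k x <= 1.
Proof.
move=> k0 x0; rewrite /cutoff le_max lexx/= ge_max ler01/=.
have a0 : 0 <= Num.min 1 (k * x)^-1 by rewrite le_min ler01 invr_ge0 mulr_ge0// ltW.
have b0 : 0 <= Num.min 1 (x / k) by rewrite le_min ler01 divr_ge0// ltW.
lra.
Qed.

Lemma cutoff_supp k x : 0 < k -> 0 < x -> cutoff k x != 0 -> k^-1 <= x <= k.
Proof.
move=> k0 x0; rewrite /cutoff; apply: contraNT.
have a0 : 0 <= (k * x)^-1 by rewrite invr_ge0 mulr_ge0// ltW.
have b0 : 0 <= x / k by rewrite divr_ge0// ltW.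
have c0 : 0 <= Num.min 1 (k * x)^-1 by rewrite le_min ler01.
have d0 : 0 <= Num.min 1 (x / k) by rewrite le_min ler01.
rewrite negb_and -!ltNge => /orP[xk|kx]; apply/eqP/max_l.
  rewrite (_ : Num.min 1 (k * x)^-1 = 1); first lra.
  by apply/min_l; rewrite invf_ge1 ?mulr_gt0// mulrC -ler_pdivlMr// div1r ltW.
rewrite (_ : Num.min 1 (x / k) = 1); first lra.
by apply/min_l; rewrite ler_pdivlMr// mul1r ltW.
Qed.

(** For x <= y, each of the two minima changes by at most (y - x) / y between x and y, and
    [Num.max 0] does not increase differences. The cases locate 1/k and k relative to x and y; when
    one of them separates x from y, that minimum is 1 at one end only. *)
Lemma cutoff_lipschitz k x y : 0 < k -> 0 < x -> 0 < y ->
  `|cutoff k x - cutoff k y| * Num.max x y <= 2 * `|x - y|.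
Proof.
move=> k0; wlog xy : x y / x <= y => [H x0 y0|x0 y0].
  have [xy|yx] := orP (le_total x y); first exact: H.
  by rewrite distrC maxC [`|x - y|]distrC; exact: H.
rewrite (max_r xy) distrC [`|x - y|]distrC (@ger0_norm _ (y - x)) ?subr_ge0//.
rewrite /cutoff.
set Ax := Num.min 1 (k * x)^-1; set Ay := Num.min 1 (k * y)^-1.
set Bx := Num.min 1 (x / k); set By := Num.min 1 (y / k).
have kx0 : 0 < k * x by rewrite mulr_gt0.
have ky0 : 0 < k * y by rewrite mulr_gt0.
have kxy : k * x <= k * y by rewrite ler_pM2l.
have inv1 (z : R) : 0 < z -> (1 <= z^-1) = (z <= 1).
  by move=> z0; rewrite invf_ge1.
have A : 0 <= (Ax - Ay) * y <= y - x.
  rewrite /Ax /Ay; have [kx1|kx1] := leP 1 (k * x).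
    rewrite !min_r ?invf_le1 ?(le_trans kx1)//.
    have -> : ((k * x)^-1 - (k * y)^-1) * y = (y - x) / (k * x).
      by field; rewrite !gt_eqF.
    rewrite divr_ge0 ?subr_ge0 ?(ltW kx0)//= ler_pdivrMr// ler_peMr// subr_ge0//.
  rewrite (@min_l _ _ 1 (k * x)^-1) ?inv1 ?(ltW kx1)//.
  have [ky1|ky1] := leP 1 (k * y).
    rewrite min_r ?invf_le1//.
    have -> : (1 - (k * y)^-1) * y = y - k^-1 by field; rewrite !gt_eqF.
    have : x <= k^-1 by rewrite -[k^-1]mul1r ler_pdivlMr// mulrC ltW.
    have : k^-1 <= y by rewrite -[k^-1]mul1r ler_pdivrMr// mulrC.
    by move=> *; apply/andP; split; lra.
  by rewrite min_l ?inv1 ?(ltW ky1)// subrr mul0r lexx subr_ge0.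
have B : 0 <= (By - Bx) * y <= y - x.
  rewrite /Bx /By; have [yk|yk] := leP y k.
    rewrite !min_r ?ler_pdivrMr ?mul1r ?(le_trans xy)//.
    have -> : (y / k - x / k) * y = (y - x) * (y / k) by ring.
    rewrite mulr_ge0 ?subr_ge0 ?divr_ge0 ?(ltW y0) ?(ltW k0)//=.
    by rewrite ler_piMr ?subr_ge0// ler_pdivrMr// mul1r.
  rewrite (@min_l _ _ 1 (y / k)) ?ler_pdivlMr ?mul1r ?(ltW yk)//.
  have [xk|xk] := leP x k.
    rewrite min_r ?ler_pdivrMr ?mul1r//.
    have -> : (1 - x / k) * y = y - x * (y / k) by ring.
    have h1 : x <= x * (y / k) by rewrite ler_peMr ?(ltW x0)// ler_pdivlMr// mul1r ltW.
    have h2 : x * (y / k) <= y.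
      by rewrite mulrCA ler_piMr ?(ltW y0)// ler_pdivrMr// mul1r.
    by apply/andP; split; lra.
  by rewrite min_l ?ler_pdivlMr ?mul1r ?(ltW xk)// subrr mul0r lexx subr_ge0.
have maxD (a b : R) : `|Num.max 0 a - Num.max 0 b| <= `|a - b|.
  have [a0|a0] := leP 0 a; have [b0|b0] := leP 0 b => //.
  - by rewrite subr0 (ger0_norm a0); apply: le_trans (ler_norm _); lra.
  - rewrite sub0r normrN (ger0_norm b0) distrC.
    by apply: le_trans (ler_norm _); lra.
  - by rewrite subrr normr0.
apply: (@le_trans _ _ (`|(1 - Ay - By) - (1 - Ax - Bx)| * y)).
  by rewrite ler_wpM2r// ltW.
rewrite -[X in _ * X <= _](gtr0_norm y0) -normrM ler_norml.
move: A B => /andP[A0 A1] /andP[B0 B1].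
have -> : (1 - Ay - By - (1 - Ax - Bx)) * y = (Ax - Ay) * y - (By - Bx) * y by ring.
by apply/andP; split; lra.
Qed.

(** The cutoff lies between 1 - (1/x + x) / k and 1. *)
Lemma cvg_cutoff x : 0 < x -> cutoff n.+1%:R x @[n --> \oo] --> (1 : R).
Proof.
move=> x0.
have c1 : 1 - (x^-1 + x) * n.+1%:R^-1 @[n --> \oo] --> (1 : R).
  rewrite -[X in _ --> X]subr0 -[X in _ --> _ - X](mulr0 (x^-1 + x)).
  apply: cvgB; first exact: cvg_cst.
  by apply: cvgMr; exact: cvg_harmonic.
apply: (squeeze_cvgr _ c1 (cvg_cst (1 : R))); apply: nearW => n /=.
have [_ ->] := andP (cutoff_itv (ltr0Sn R n) x0); rewrite andbT.
rewrite /cutoff le_max; apply/orP; right.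
have h1 : Num.min 1 (n.+1%:R * x)^-1 <= (n.+1%:R * x)^-1 by rewrite ge_min lexx orbT.
have h2 : Num.min 1 (x / n.+1%:R) <= x / n.+1%:R by rewrite ge_min lexx orbT.
have -> : (x^-1 + x) / n.+1%:R = (n.+1%:R * x)^-1 + x / n.+1%:R.
  by rewrite mulrDl invfM mulrC.
by rewrite opprD addrA; apply: lerB => //; apply: lerB.
Qed.

End Cutoff.

(** * Locally Lipschitz functions on the half-line *)

Section Regularity.
Context {R : realType}.
Local Notation mu := (@lebesgue_measure R).
Implicit Types (g : R -> R).

(* [[locally [lipschitz g y | y in pos]]] localizes at points of [pos `*` pos];
   only the points of the diagonal are used. *)
Lemma locally_lipschitz_near g (x : R) :
  [locally [lipschitz g y | y in pos]] -> 0 < x ->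
  exists M r : R, [/\ 0 < M, 0 < r & forall y z, 0 < y -> 0 < z ->
    `|x - y| < r -> `|x - z| < r -> `|g y - g z| <= M * `|y - z|].
Proof.
move=> lg x0; have := lg (x, x); rewrite /= !posE => /(_ (conj x0 x0)).
rewrite /lipschitz_on /= => lM.
have [M [M0 HM]] : exists M : R, 0 < M /\
    M.-lipschitz_on [eta g] (within (pos `*` pos) (nbhs (x, x))).
  near (pinfty_nbhs R) => M; exists M; split.
    by near: M; exact: nbhs_pinfty_gt.
  by near: M.
move: HM; rewrite /dominated_by /within /= => /nbhs_ballP[r /= r0 Hr].
exists M, r; split => // y z y0 z0 xy xz.
apply: (Hr (y, z)); last by rewrite /= !posE.
by split => /=; rewrite /ball/=.
Unshelve. all: by end_near. Qed.

Lemma locally_lipschitz_continuous g :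
  [locally [lipschitz g y | y in pos]] -> {in pos, continuous g}.
Proof.
move=> lg x /set_mem; rewrite posE => x0.
have [M [r [M0 r0 Hr]]] := locally_lipschitz_near lg x0.
apply/cvgrPdist_lt => e e0; near=> y.
have y0 : 0 < y by near: y; exact: lt_nbhsr.
have xyr : `|x - y| < r.
  by near: y; exact: (@cvgr_dist_lt _ _ _ (nbhs x) _ id x).
apply: le_lt_trans (Hr x y x0 y0 _ xyr) _; first by rewrite subrr normr0.
rewrite mulrC -ltr_pdivlMr//; near: y.
by apply: (@cvgr_dist_lt _ _ _ (nbhs x) _ id x) => //; rewrite divr_gt0.
Unshelve. all: by end_near. Qed.

(** Only x is confined to a compact interval, while y ranges over the half-line. Near x the local
    Lipschitz constant works; away from x the increment is at most 2C, hence a multiple of the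
    distance. Compactness makes the constant uniform. *)
Lemma lipschitz_bound g (C a b : R) : (forall x, 0 < x -> `|g x| <= C) ->
  [locally [lipschitz g y | y in pos]] -> 0 < a ->
  exists2 Lam : R, 0 <= Lam & forall x, a <= x <= b -> forall y, 0 < y ->
    `|g y - g x| <= Lam * `|x - y|.
Proof.
move=> gC lg a0.
have C0 : 0 <= C by rewrite (le_trans _ (gC 1 _))//.
(* The parameter of the covering argument is the constant [Lam], along the filter at +oo: each point
   needs the estimate only nearby and for all large [Lam]. *)
have /compact_near_coveringP := @segment_compact R a b.
move=> /(_ _ (pinfty_nbhs R) (fun Lam x => forall y, 0 < y ->
  `|g y - g x| <= Lam * `|x - y|) _) cov.
have {cov} : \forall Lam \near +oo, `[a, b] `<=` (fun x => forall y, 0 < y ->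
    `|g y - g x| <= Lam * `|x - y|).
  apply: cov => x /=; rewrite in_itv/= => /andP[ax _].
  have x0 : 0 < x := lt_le_trans a0 ax.
  have [M [r [M0 r0 Hr]]] := locally_lipschitz_near lg x0.
  near=> x' Lam => y y0 /=.
  have x'0 : 0 < x' by near: x'; exact: lt_nbhsr.
  have xx' : `|x - x'| < r / 2.
    by near: x'; apply: (@cvgr_dist_lt _ _ _ (nbhs x) _ id x) => //; rewrite divr_gt0.
  have [xyr|xyr] := ltP `|x - y| r.
    rewrite distrC; apply: le_trans (Hr x' y x'0 y0 _ xyr) _.
      by rewrite (lt_trans xx')// ltr_pdivrMr// ltr_pMr// ltr1n.
    by rewrite ler_wpM2r//; near: Lam; exact: nbhs_pinfty_ge.
  have x'y : r / 2 <= `|x' - y|.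
    have := ler_distD x' x y; lra.
  apply: (@le_trans _ _ (2 * C)).
    rewrite (le_trans (ler_normB _ _))// mulr2n mulrDl mul1r lerD// gC//.
  apply: (@le_trans _ _ (2 * C / (r / 2) * `|x' - y|)).
    have r20 : 0 < r / 2 by rewrite divr_gt0.
    rewrite -[leLHS](@divfK _ (r / 2)) ?gt_eqF// ler_wpM2l//.
    by apply: divr_ge0; [rewrite mulr_ge0|exact: ltW].
  by rewrite ler_wpM2r//; near: Lam; exact: nbhs_pinfty_ge.
move=> H; near (pinfty_nbhs R) => Lam; exists Lam.
  by near: Lam; exact: nbhs_pinfty_ge.
move=> x xab; have : `[a, b] `<=` (fun x => forall y, 0 < y ->
    `|g y - g x| <= Lam * `|x - y|) by near: Lam.
by apply; rewrite /= in_itv.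
Unshelve. all: by end_near. Qed.

(** At a point where the bound fails, continuity makes it fail on an interval just to the right,
    which has positive measure. *)
Lemma ae_bounded_continuous g (C : R) : {in pos, continuous g} ->
  {ae mu, forall x, 0 < x -> `|g x| <= C} -> forall x, 0 < x -> `|g x| <= C.
Proof.
move=> cg [N [mN N0 subN]] x x0; rewrite leNgt; apply/negP => Cgx.
have : \forall y \near x, C < `|g y|.
  apply: (@cvgr_gt _ _ (nbhs x) _ (fun y => `|g y|) `|g x|) => //.
  by apply: cvg_norm; apply: cg; rewrite inE posE.
move=> /nbhs_ballP[r /= r0 Hr].
have : (mu `]x, (x + r)%R[ <= mu N)%E.
  apply: le_measure; rewrite ?inE//.
  move=> y /=; rewrite in_itv/= => /andP[xy yxr]; apply: subN => /= H.
  have := H (lt_trans x0 xy); apply/negP; rewrite -ltNge; apply: Hr.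
  by rewrite /ball/= distrC gtr0_norm ?subr_gt0// ltrBlDl.
rewrite [X in (_ <= X)%E](_ : _ = 0%E); last exact: N0.
rewrite lebesgue_measure_itv/= lte_fin ltrDl r0 -EFinB lee_fin.
by rewrite leNgt subr_gt0 ltrDl r0.
Qed.

End Regularity.

(** * Cancellation of the energy flux *)

Section EnergyCancellation.
Context {R : realType}.
Local Notation mu := (@lebesgue_measure R).
Local Notation mu2 := (mu \x mu)%E.
Implicit Types (g : R -> R).

Lemma integrable_tensor (q : R -> R) : mu.-integrable pos (EFin \o q) ->
  mu2.-integrable (pos `*` pos) (EFin \o (fun z => q z.1 * q z.2)).
Proof.
move=> qi; have mpos := @measurable_pos R.
have Qi : mu.-integrable setT ((EFin \o q) \_ pos).
  exact: (@integrable_mkcond _ (measurableTypeR R) _ mu pos (EFin \o q) mpos).1.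
pose Q := q \_ pos.
have QE : (EFin \o q) \_ pos = EFin \o Q by rewrite restrict_EFin.
rewrite QE in Qi.
have mQ : measurable_fun setT Q by apply/measurable_EFinP; exact: measurable_int Qi.
have Q2 : mu2.-integrable setT (EFin \o (fun z => Q z.1 * Q z.2)).
  apply/integrable12ltyP.
    apply/measurable_EFinP; apply: measurable_funM.
      exact: (measurableT_comp mQ measurable_fst).
    exact: (measurableT_comp mQ measurable_snd).
  have /integrableP[_ Qfin] := Qi.
  pose I := (\int[mu]_y `|(EFin \o Q) y|)%E.
  rewrite [X in (X < _)%E](_ : _ = \int[mu]_x (I * `|(EFin \o Q) x|))%E; last first.
    apply: eq_integral => x _; rewrite /I -ge0_integralZr//.
    - by apply: eq_integral => y _ /=; rewrite normrM EFinM muleC.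
    - by apply/measurable_EFinP; exact: measurableT_comp.
  rewrite ge0_integralZl//.
  - by rewrite lte_mul_pinfty// ?integral_ge0// ge0_fin_numE ?integral_ge0.
  - by apply/measurable_EFinP; exact: measurableT_comp.
  - exact: integral_ge0.
have mposX : measurable (pos `*` pos : set (measurableTypeR R * measurableTypeR R)).
  exact: measurableX.
have Q2' : mu2.-integrable (pos `*` pos) (EFin \o (fun z => Q z.1 * Q z.2)).
  by apply: integrableS Q2.
apply: eq_integrable Q2' => //.
by move=> z /set_mem[z1 z2] /=; rewrite /Q !patchE !mem_set.
Qed.

Lemma measurable_sinh : measurable_fun [set: R] (@sinh R).
Proof.
apply: continuous_measurable_fun => x.
apply: cvgM; last exact: cvg_cst.
apply: cvgB; first exact: continuous_expR.
apply: (@continuous_comp _ _ _ -%R expR); last exact: continuous_expR.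
exact: opp_continuous.
Qed.

Lemma measurable_symM : measurable_fun [set: R * R] (fun z => symM z.1 z.2).
Proof.
have m1 n : measurable_fun [set: R * R] (fun z => z.1 ^+ n).
  by apply: measurable_funX; exact: measurable_fst.
have m2 n : measurable_fun [set: R * R] (fun z => z.2 ^+ n).
  by apply: measurable_funX; exact: measurable_snd.
have minv (f : R * R -> R) : measurable_fun setT f ->
    measurable_fun setT (fun z => (f z)^-1).
  by move=> mf; exact: (measurableT_comp measurable_invr mf).
have msinh (f : R * R -> R) : measurable_fun setT f ->
    measurable_fun setT (fun z => sinh (f z)).
  by move=> mf; exact: (measurableT_comp measurable_sinh mf).
have mabs : measurable_fun setT (fun z : R * R => `|z.1 ^+ 2 - z.2 ^+ 2|).
  by apply: measurableT_comp; [exact: normr_measurable|exact: measurable_funB].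
apply: measurable_funM; first apply: measurable_funB.
- exact: (minv _ (msinh _ mabs)).
- exact: (minv _ (msinh _ (measurable_funD (m1 2%N) (m2 2%N)))).
- apply: measurable_funM; first exact: measurable_funM.
  refine (minv _ (measurable_funM _ (msinh _ (m2 2%N)))).
  exact: (measurable_funM (measurable_cst _) (msinh _ (m1 2%N))).
Qed.

Variables (beta0 : R) (g : R -> R) (C : R).
Hypothesis beta0_gt0 : 0 < beta0.
Hypothesis g_bounded : forall x, 0 < x -> `|g x| <= C.
Hypothesis g_lipschitz : [locally [lipschitz g x | x in pos]].

Let mpos := @measurable_pos R.

Let mposX : measurable (pos `*` pos : set (measurableTypeR R * measurableTypeR R)).
Proof. exact: measurableX. Qed.

Let q (x : R) := (1 + x ^+ 2)^-1.

Let q_ge0 x : 0 <= q x. Proof. by rewrite invr_ge0 addr_ge0// sqr_ge0. Qed.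

Let mg : measurable_fun pos g.
Proof.
apply: open_continuous_measurable_fun; first exact: open_pos.
exact: locally_lipschitz_continuous.
Qed.

(** The truncation acts on the first variable only, so that integrating in the second recovers the
    cutoff times the weighted [L g]; the symmetry is exploited afterwards. *)
Let flux (n : nat) (z : R * R) : R :=
  cutoff n.+1%:R z.1 * ((g z.2 - g z.1) * symM z.1 z.2).

Let measurable_gfst : measurable_fun (pos `*` pos) (fun z : R * R => g z.1).
Proof.
apply: (@measurable_comp _ _ _ _ _ _ pos) => //; first by move=> _ [z [z1 _] <-].
by apply: measurable_funTS; exact: measurable_fst.
Qed.

Let measurable_gsnd : measurable_fun (pos `*` pos) (fun z : R * R => g z.2).
Proof.
apply: (@measurable_comp _ _ _ _ _ _ pos) => //; first by move=> _ [z [_ z2] <-].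
by apply: measurable_funTS; exact: measurable_snd.
Qed.

Let measurable_gdiffM :
  measurable_fun (pos `*` pos) (fun z : R * R => (g z.2 - g z.1) * symM z.1 z.2).
Proof.
apply: measurable_funM; first exact: measurable_funB.
by apply: measurable_funTS; exact: measurable_symM.
Qed.

Let measurable_flux n : measurable_fun (pos `*` pos) (flux n).
Proof.
apply: measurable_funM => //.
apply: (@measurable_funTS _ _ _ _ _ (fun z : R * R => cutoff n.+1%:R z.1)).
by apply: (measurableT_comp (measurable_cutoff _)); exact: measurable_fst.
Qed.

(** On the support of the cutoff, x lies in [1/k, k] with k = n + 1. There [g] has a Lipschitz
    constant valid against all y, and x y / (x + y) <= k in [symM_bound]. The resulting constant
    grows with n and only justifies Fubini. *)
Let flux_bound n : exists2 K : R, 0 <= K & forall x y, 0 < x -> 0 < y ->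
  cutoff n.+1%:R x != 0 -> `|(g y - g x) * symM x y| <= K * (q x * q y).
Proof.
have k0 : 0 < n.+1%:R :> R by [].
have kV0 : 0 < n.+1%:R^-1 :> R by rewrite invr_gt0.
have [Lam Lam0 HLam] := lipschitz_bound n.+1%:R g_bounded g_lipschitz kV0.
exists (Lam * (128 * n.+1%:R)); first by rewrite !mulr_ge0.
move=> x y x0 y0 /(cutoff_supp k0 x0) xk.
rewrite normrM; apply: (@le_trans _ _ (Lam * `|x - y| * `|symM x y|)).
  by rewrite ler_wpM2r// HLam.
apply: (@le_trans _ _ (Lam * (128 * (x * y / (x + y)) * (q x * q y)))).
  by rewrite -mulrA ler_wpM2l// symM_bound.
rewrite -[leRHS]mulrA ler_wpM2l// ler_wpM2r ?mulr_ge0// ler_wpM2l//.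
rewrite ler_pdivrMr ?addr_gt0//; case/andP: xk => _ xk.
by rewrite ler_pM ?(ltW x0) ?(ltW y0)// lerDr ltW.
Qed.

Let cutoff1 n (x : R) : 0 < x -> 0 <= cutoff n.+1%:R x <= 1.
Proof. exact: cutoff_itv. Qed.

Let flux_le n : exists2 K : R, 0 <= K & forall x y, 0 < x -> 0 < y ->
  `|flux n (x, y)| <= K * (q x * q y).
Proof.
have [K K0 HK] := flux_bound n; exists K => // x y x0 y0; rewrite /flux /=.
have [->|cx] := eqVneq (cutoff n.+1%:R x) 0.
  by rewrite mul0r normr0 !mulr_ge0.
have /andP[c0 c1] := cutoff1 n x0.
rewrite normrM (ger0_norm c0); apply: le_trans (HK x y x0 y0 cx).
by rewrite ler_piMl.
Qed.

Let integrable_Kqq (K : R) :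
  mu2.-integrable (pos `*` pos) (EFin \o (fun z => K * (q z.1 * q z.2))).
Proof.
apply: integrable_cstM mposX _; exact: integrable_tensor integrable_oneDsqrV.
Qed.

Let swap_flux n (z : R * R) := flux n (z.2, z.1).

Let integrable_flux n : mu2.-integrable (pos `*` pos) (EFin \o flux n).
Proof.
have [K K0 HK] := flux_le n.
apply: (integrable_le mposX (measurable_flux n) _ (integrable_Kqq K)).
by case=> x y [/=]; rewrite !posE; exact: HK.
Qed.

Let measurable_swap_flux n : measurable_fun (pos `*` pos) (swap_flux n).
Proof.
apply: (@measurable_comp _ _ _ _ _ _ (pos `*` pos)) => //.
  by move=> _ [[x y] [/= x0 y0] <-].
by apply: measurable_funTS; exact: measurable_swap.
Qed.

Let integrable_swap_flux n :
  mu2.-integrable (pos `*` pos) (EFin \o swap_flux n).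
Proof.
have [K K0 HK] := flux_le n.
apply: (integrable_le mposX (measurable_swap_flux n) _ (integrable_Kqq K)).
case=> x y [/=]; rewrite !posE => x0 y0.
by rewrite [q x * _]mulrC; exact: HK.
Qed.

Let cutoff_L n (x : R) : 0 < x ->
  cutoff n.+1%:R x * (weight beta0 6 x * L g x) =
  \int[mu]_(y in pos) flux n (x, y).
Proof.
move=> x0; rewrite /flux /=.
have [->|cx] := eqVneq (cutoff n.+1%:R x) 0.
  rewrite mul0r (@eq_Rintegral _ _ _ _ _ (cst 0)).
    by rewrite Rintegral_cst ?mul0r.
  by move=> y _; rewrite mul0r.
have [K K0 HK] := flux_bound n.
have mdiff : measurable_fun pos (fun y => (g y - g x) * symM x y).
  apply: measurable_funM; first exact: measurable_funB.
  apply: (@measurable_funTS _ _ _ _ _ ((fun z : R * R => symM z.1 z.2) \o pair x)).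
  exact: (measurableT_comp measurable_symM (pair1_measurable x)).
have isym : mu.-integrable pos (EFin \o (fun y => (g y - g x) * symM x y)).
  have iq : mu.-integrable pos (EFin \o (fun y => K * q x * q y)).
    by apply: integrable_cstM; [exact: mpos|exact: integrable_oneDsqrV].
  apply: (@integrable_le _ (measurableTypeR R) R mu pos _ _ mpos mdiff _ iq) => y.
  rewrite posE => y0.
  by rewrite -mulrA; exact: HK.
(* Dividing by the positive weight writes the integrand of [L g] through [symM], whose integrability
   in y is known, so that the weight can be moved through the integral. *)
have w0 := weight_gt0 6 beta0_gt0 x0.
have E y : 0 < y ->
    (g y - g x) * M x y = (weight beta0 6 x)^-1 * ((g y - g x) * symM x y).
  move=> y0; rewrite -(weight_M beta0_gt0 x0 y0) [in RHS]mulrCA mulKf// gt_eqF//.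
rewrite RintegralZl//; congr (_ * _).
transitivity (weight beta0 6 x * \int[mu]_(y in pos)
    ((weight beta0 6 x)^-1 * ((g y - g x) * symM x y))); last first.
  by rewrite RintegralZl// mulVKf// gt_eqF.
congr (_ * _); apply: eq_Rintegral.
by move=> y /set_mem; rewrite posE; exact: E.
Qed.

Let I n := \int[mu2]_(z in pos `*` pos) flux n z.

Let cutoff_moment n :
  \int[mu]_(x in pos) (cutoff n.+1%:R x * (weight beta0 6 x * L g x)) = I n.
Proof.
rewrite /I (Rintegral_prod_fst mpos mpos (integrable_flux n)).
by apply: eq_Rintegral => x /set_mem; rewrite posE; exact: cutoff_L.
Qed.

(** Fubini in the two orders gives the same iterated integral up to the names of the variables. *)
Let I_swap n : I n = \int[mu2]_(z in pos `*` pos) swap_flux n z.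
Proof.
rewrite /I (Rintegral_prod_fst mpos mpos (integrable_flux n)).
by rewrite (Rintegral_prod_snd mpos mpos (integrable_swap_flux n)).
Qed.

Let double_flux n (z : R * R) : R :=
  (cutoff n.+1%:R z.1 - cutoff n.+1%:R z.2) *
  ((g z.2 - g z.1) * symM z.1 z.2).

(** Under exchange of x and y, [symM] is invariant and the increment of [g] changes sign, so the sum
    of the two fluxes carries the difference of the cutoffs. *)
Let I2 n : 2 * I n = \int[mu2]_(z in pos `*` pos) double_flux n z.
Proof.
rewrite mulrDl mul1r {2}I_swap -RintegralD//.
apply: eq_Rintegral => -[x y] _.
by rewrite /swap_flux /flux /double_flux /= (symMC y x); ring.
Qed.

(** The bound does not depend on n. The increment of [g] contributes 2C; multiplying
    [cutoff_lipschitz] by [symM_bound] gives 256 = 2 * 128, the factor max(x, y) being absorbed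
    through x y / (x + y) <= max(x, y). *)
Let double_flux_le n x y : 0 < x -> 0 < y ->
  `|double_flux n (x, y)| <= 2 * C * 256 * (q x * q y).
Proof.
move=> x0 y0; rewrite /double_flux /=.
have C0 : 0 <= C by apply: le_trans (g_bounded x0).
rewrite normrM [X in _ * X]normrM.
have gle : `|g y - g x| <= 2 * C.
  by rewrite (le_trans (ler_normB _ _))// mulr2n mulrDl mul1r lerD// g_bounded.
rewrite mulrCA -[leRHS]mulrA; apply: ler_pM => //.
have [->|xy] := eqVneq x y; first by rewrite subrr normr0 mul0r !mulr_ge0.
have d0 : 0 < `|x - y| by rewrite normr_gt0 subr_eq0.
have m0 : 0 < Num.max x y by rewrite lt_max x0.
rewrite -(ler_pM2l (mulr_gt0 m0 d0)).
have h1 := cutoff_lipschitz (ltr0Sn R n) x0 y0.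
have h2 := symM_bound x0 y0.
have h3 : x * y / (x + y) <= Num.max x y.
  rewrite ler_pdivrMr ?addr_gt0// mulrDr ler_wpDl ?mulr_ge0 ?(ltW m0) ?(ltW x0)//.
  by rewrite ler_wpM2r ?(ltW y0)// le_max lexx.
have h4 := ler_pM (mulr_ge0 (normr_ge0 _) (ltW m0))
  (mulr_ge0 (normr_ge0 _) (normr_ge0 _)) h1 h2.
rewrite [leLHS](_ : _ = `|cutoff n.+1%:R x - cutoff n.+1%:R y| * Num.max x y *
  (`|x - y| * `|symM x y|)); last by ring.
apply: le_trans h4 _.
rewrite [leLHS](_ : _ = `|x - y| * 256 * (q x * q y) * (x * y / (x + y))).
  rewrite [leRHS](_ : _ = `|x - y| * 256 * (q x * q y) * Num.max x y).
    by rewrite ler_wpM2l// !mulr_ge0.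
  by ring.
by rewrite /q; ring.
Qed.

Let measurable_double_flux n : measurable_fun (pos `*` pos) (double_flux n).
Proof.
apply: measurable_funM => //.
apply: (@measurable_funTS _ _ _ _ _
  (fun z : R * R => cutoff n.+1%:R z.1 - cutoff n.+1%:R z.2)).
apply: measurable_funB.
  by apply: (measurableT_comp (measurable_cutoff _)); exact: measurable_fst.
by apply: (measurableT_comp (measurable_cutoff _)); exact: measurable_snd.
Qed.

Let cvg_I : I n @[n --> \oo] --> (0 : R).
Proof.
have [||||_] := @dominated_Rintegral _ _ _ mu2 (pos `*` pos) double_flux (cst 0)
  (fun z => 2 * C * 256 * (q z.1 * q z.2)) mposX.
- exact: measurable_double_flux.
- case=> x y [/=]; rewrite !posE => x0 y0; rewrite /double_flux /=.
  rewrite -[X in _ --> X](mul0r ((g y - g x) * symM x y)).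
  apply: cvgMl; rewrite -[X in _ --> X](subrr 1).
  by apply: cvgB; exact: cvg_cutoff.
- by move=> n [x y] [/=]; rewrite !posE; exact: double_flux_le.
- exact: integrable_Kqq.
rewrite Rintegral_cst// mul0r.
move=> h; rewrite -[X in _ --> X](mulr0 2^-1).
rewrite (_ : I = fun n => 2^-1 * \int[mu2]_(z in pos `*` pos) double_flux n z).
  exact: cvgMr.
by apply/funext => n; rewrite -I2 mulKf.
Qed.

(** The sequence [I n] has two limits: 0 by symmetrization, and the moment, because the truncated
    integrands are dominated by 16 |L g|. *)
Lemma moment6_L_eq0 : L1 (L g) -> moment beta0 6 (L g) = 0.
Proof.
move=> LgL1.
have mLg : measurable_fun pos (L g).
  by apply/measurable_EFinP; exact: measurable_int LgL1.
have mw : measurable_fun pos (weight beta0 6).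
  apply: (measurable_weight 6 beta0_gt0).
have [||||_] := @dominated_Rintegral _ _ _ mu pos
  (fun n x => cutoff n.+1%:R x * (weight beta0 6 x * L g x))
  (fun x => weight beta0 6 x * L g x) (fun x => 16 * `|L g x|) mpos.
- move=> n; apply: measurable_funM; last exact: measurable_funM.
  by apply: measurable_funTS; exact: measurable_cutoff.
- move=> x; rewrite posE => x0.
  rewrite -[X in _ --> X]mul1r; apply: cvgMl; exact: cvg_cutoff.
- move=> n x; rewrite posE => x0; have /andP[c0 c1] := cutoff1 n x0.
  have [_ w16] := weight_le beta0_gt0 x0.
  rewrite normrM [X in _ * X]normrM (ger0_norm c0).
  rewrite (gtr0_norm (weight_gt0 6 beta0_gt0 x0)).
  apply: (@le_trans _ _ (weight beta0 6 x * `|L g x|)); last by rewrite ler_wpM2r.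
  by rewrite ler_piMl// mulr_ge0// ltW// weight_gt0.
- apply: integrable_cstM mpos _.
  by have := integrable_abse LgL1.
under eq_fun do rewrite cutoff_moment.
move=> cvgm; have := cvg_unique _ cvgm cvg_I.
rewrite /moment => <-; last exact: Rhausdorff.
by apply: eq_Rintegral => x _; rewrite /weight mulrAC.
Qed.

End EnergyCancellation.

(** * Weak formulation of the moment equations *)

Section TestFunctions.
Context {R : realType}.
Implicit Types (phi psi a : R -> R).

(** The argument (k x - 1)(k - x) is positive between 1/k and k and tends to infinity with k. The
    value exp(-1/z) is below 1 everywhere but converges to 1 at each x > 0. *)
Definition plateau (k x : R) : R := flat 0 (k * (x - k^-1) * (k - x)).

Lemma plateau_itv k x : 0 <= plateau k x <= 1.
Proof. exact: flat0_itv. Qed.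

(** The condition 1 <= k orders the two roots: for k < 1 both linear factors would be negative
    between k and 1/k. *)
Lemma plateau_eq0 k x : 1 <= k -> ~ (k^-1 <= x <= k) -> plateau k x = 0.
Proof.
move=> k1 xk; apply: flat_le0.
have k0 : 0 < k := lt_le_trans ltr01 k1.
have kV1 : k^-1 <= 1 by rewrite invf_le1.
move/negP: xk; rewrite negb_and -!ltNge => /orP[xk|kx].
  rewrite mulr_le0_ge0//; last by lra.
  by rewrite mulr_ge0_le0 ?(ltW k0)//; lra.
rewrite mulr_ge0_le0//; last by lra.
by rewrite mulr_ge0 ?(ltW k0)//; lra.
Qed.

Lemma smooth_plateau k : smooth (plateau k).
Proof.
move=> n; apply: (@diffn_comp _ _ _ setT) => //; first exact: smooth_flat.
rewrite (_ : (fun _ => _) =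
    (cst k \* (id \+ cst (- k^-1))) \* (cst k \+ (cst (-1) \* id))).
  apply: diffnM.
    apply: diffnM; first exact: diffn_cst.
    by apply: diffnD; [exact: diffn_id|exact: diffn_cst].
  apply: diffnD; first exact: diffn_cst.
  by apply: diffnM; [exact: diffn_cst|exact: diffn_id].
by apply/funext => x /=; rewrite mulN1r.
Qed.

Lemma cvg_plateau x : 0 < x -> plateau n.+1%:R x @[n --> \oo] --> (1 : R).
Proof.
move=> x0.
have c1 : 1 - 2 * n.+1%:R^-1 @[n --> \oo] --> (1 : R).
  rewrite -[X in _ --> X]subr0 -[X in _ --> _ - X](mulr0 2).
  by apply: cvgB; [exact: cvg_cst|apply: cvgMr; exact: cvg_harmonic].
apply: (squeeze_cvgr _ c1 (cvg_cst (1 : R))).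
(* The two bounds on 1/k give k x >= 2 and k >= 2x, so the argument of [flat] is at least k/2, and
   exp(-2/k) >= 1 - 2/k. *)
have e0 : 0 < Num.min (x / 2) ((2 * x)^-1).
  by rewrite lt_min divr_gt0//= invr_gt0 mulr_gt0.
near=> n => /=; have [_ ->] := andP (plateau_itv n.+1%:R x); rewrite andbT.
have : n.+1%:R^-1 < Num.min (x / 2) ((2 * x)^-1).
  by near: n; exact: near_infty_natSinv_lt (PosNum e0).
have k0 : 0 < n.+1%:R :> R by [].
move: (n.+1%:R : R) k0 => k k0; rewrite lt_min => /andP[kx xk].
have xk' : 2 * x < k.
  by move: xk; rewrite ltf_pV2 ?posrE// mulr_gt0.
have kV0 : 0 < k^-1 by rewrite invr_gt0.
have kx' : 1 <= k * (x - k^-1).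
  rewrite mulrBr divff ?gt_eqF//.
  have : k * (2 * k^-1) <= k * x by rewrite ler_pM2l//; lra.
  by rewrite mulrCA divff ?gt_eqF//; lra.
have kz : k / 2 <= k * (x - k^-1) * (k - x).
  by have := @ler_pM _ 1 (k * (x - k^-1)) (k / 2) (k - x); rewrite mul1r; apply; lra.
have k20 : 0 < k / 2 by rewrite divr_gt0.
have z0 := lt_le_trans k20 kz.
rewrite /plateau /flat z0 mul1r.
apply: le_trans (expR_ge1Dx _); rewrite lerD2l lerN2 -[2 * k^-1]invf_div lef_pV2//.
Unshelve. all: by end_near. Qed.

(** Nothing is assumed on [a] outside (0, oo): the product vanishes identically to the left of 1/k,
    so smoothness is glued from two overlapping open sets. *)
Lemma smooth_mul_plateau a k : 1 <= k -> (forall n, diffn n pos a) ->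
  smooth (fun x => a x * plateau k x).
Proof.
move=> k1 sa n; apply: diffn_local => x.
have k0 : 0 < k := lt_le_trans ltr01 k1.
have kV0 : 0 < k^-1 by rewrite invr_gt0.
have [x0|x0] := ltP 0 x.
  exists pos; rewrite posE; split => //.
  apply: diffnM; first exact: sa.
  apply: (@diffn_sub _ n setT) => //; exact: smooth_plateau.
exists `]-oo, k^-1[%classic; split; first exact: interval_open.
  by rewrite /= in_itv/= (le_lt_trans x0).
apply: (@eq_diffn _ n _ (cst 0)); first exact: interval_open.
  move=> y /=; rewrite in_itv/= => yk; rewrite plateau_eq0 ?mulr0// => /andP[].
  by rewrite leNgt yk.
exact: diffn_cst.
Qed.

Lemma pos_supp_mul_plateau a k : 1 <= k -> pos_supp (fun x => a x * plateau k x).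
Proof.
move=> k1; exists k^-1, k; split; first by rewrite invr_gt0 (lt_le_trans ltr01).
by move=> x /(plateau_eq0 k1) ->; rewrite mulr0.
Qed.

Lemma pos_supp_bounded phi : continuous phi -> pos_supp phi ->
  exists2 K : R, 0 <= K & forall x, `|phi x| <= K.
Proof.
move=> cphi [a [b [a0 phi0]]].
have : bounded_set [set phi x | x in `[a, b]].
  apply: compact_bounded; apply: continuous_compact; last exact: segment_compact.
  exact: continuous_subspaceT.
move=> /pinfty_ex_gt0[K K0 HK]; exists (Num.max 0 K); first by rewrite le_max lexx.
move=> x; rewrite le_max; have [xab|/negP xab] := boolP (a <= x <= b).
  by apply/orP; right; apply: HK; exists x => //=; rewrite in_itv.
by rewrite (phi0 _ xab) normr0 lexx.
Qed.

Lemma dt_tensor phi psi : smooth phi ->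
  dt (fun t x => phi t * psi x) = fun t x => derive1 phi t * psi x.
Proof.
move=> sphi; apply/funext => t; apply/funext => x; rewrite /dt !derive1E.
rewrite (_ : (fun t => _) = (psi x) \o* phi); last by apply/funext.
rewrite deriveMr 1?mulrC//; exact: smooth_derivable.
Qed.

Lemma Cn2_tensor n phi psi : smooth phi -> smooth psi ->
  Cn2 n (fun t x => phi t * psi x).
Proof.
elim: n phi psi => [|n IHn] phi psi sphi spsi.
  split => // z; apply: cvgM.
    by apply: continuous_comp; [exact: cvg_fst|exact: smooth_continuous].
  by apply: continuous_comp; [exact: cvg_snd|exact: smooth_continuous].
split.
  move=> z; apply: cvgM.
    by apply: continuous_comp; [exact: cvg_fst|exact: smooth_continuous].
  by apply: continuous_comp; [exact: cvg_snd|exact: smooth_continuous].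
split.
- move=> t x; apply: derivableM => //; exact: smooth_derivable.
- move=> t x; apply: derivableM => //; exact: smooth_derivable.
- by rewrite dt_tensor//; apply: IHn => //; exact: smooth_derive1.
- rewrite (_ : dx _ = fun t x => phi t * derive1 psi x).
    by apply: IHn => //; exact: smooth_derive1.
  apply/funext => t; apply/funext => x; rewrite /dx !derive1E.
  rewrite (_ : (fun x => _) = (phi t) \*o psi); last by apply/funext.
  rewrite deriveMl//; exact: smooth_derivable.
Qed.

Lemma test2_tensor phi psi : smooth phi -> pos_supp phi ->
  smooth psi -> pos_supp psi -> test2 (fun t x => phi t * psi x).
Proof.
move=> sphi [a [b [a0 phi0]]] spsi [c [d [c0 psi0]]].
split; first by move=> n; exact: Cn2_tensor.
exists (Num.min a c), (Num.max b d); split; first by rewrite lt_min a0.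
move=> t x tx.
have [tab|/negP tab] := boolP (a <= t <= b); last by rewrite phi0 ?mul0r.
have [xcd|/negP xcd] := boolP (c <= x <= d); last by rewrite psi0 ?mulr0.
case: tx; rewrite !ge_min !le_max.
by move: tab xcd => /andP[-> ->] /andP[-> ->]; rewrite !orbT.
Qed.

End TestFunctions.

(** * Weak time derivatives of weighted integrals *)

Section WeakMoments.
Context {R : realType}.
Local Notation mu := (@lebesgue_measure R).
Local Notation mu2 := (mu \x mu)%E.
Implicit Types (u w : R -> R -> R) (a phi : R -> R).

Let mpos := @measurable_pos R.

Let mposX : measurable (pos `*` pos : set (measurableTypeR R * measurableTypeR R)).
Proof. exact: measurableX. Qed.

(** The measures of the sections of a null set integrate to its measure 0, hence almost every
    section is null. *)
Lemma ae_slice (Q : R * R -> Prop) : {ae mu2, forall z, Q z} ->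
  {ae mu, forall t, {ae mu, forall x, Q (t, x)}}.
Proof.
move=> [N [mN N0 subN]].
have mxN t : measurable (xsection N t) by exact: measurable_xsection.
have /(ae_eq_integral_abs mu measurableT) :
    (\int[mu]_t `|(mu \o xsection N) t| = 0)%E.
  rewrite -[RHS]N0; apply: eq_integral => t _; rewrite gee0_abs//.
move=> /(_ (measurable_fun_xsection _ mN)) N0t.
apply: filterS N0t => t /(_ I) Nt.
exists (xsection N t); split => // x /= Qx.
by rewrite /xsection/= inE; exact: subN.
Qed.

Definition integral_against u a (t : R) : R := \int[mu]_(x in pos) (u t x * a x).

Lemma L1_cvg_within u (F : R -> R) (K : R) : continuous_L1 u ->
  (forall t t0, 0 <= t -> 0 <= t0 ->
    `|F t - F t0| <= K * \int[mu]_(x in pos) `|u t x - u t0 x|) ->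
  forall t0 : R, 0 <= t0 -> F t @[t --> within [set t | 0 <= t] (nbhs t0)] --> F t0.
Proof.
move=> [_ cu] HF t0 t00.
have c0 : K * \int[mu]_(x in pos) `|u t x - u t0 x|
    @[t --> within [set t | 0 <= t] (nbhs t0)] --> (0 : R).
  rewrite -[X in _ --> X](mulr0 K); apply: cvgMr.
  exact: (fine_cvg (cu t0 t00)).
apply/cvgrPdist_lt => e e0; near=> t.
have tge0 : 0 <= t by near: t; exact: withinT.
rewrite distrC; apply: le_lt_trans (HF t t0 tge0 t00) _.
by near: t; exact: (cvgr_lt _ c0).
Unshelve. all: by end_near. Qed.

Lemma within_ge0_continuous (F : R -> R) :
  (forall t0 : R, 0 <= t0 -> F t @[t --> within [set t | 0 <= t] (nbhs t0)] --> F t0) ->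
  {in pos, continuous F}.
Proof.
move=> cF t0 /set_mem; rewrite posE => t00.
apply/cvgrPdist_lt => e e0.
have /cvgrPdist_lt/(_ e e0) := cF t0 (ltW t00).
rewrite near_withinE => H; near=> t.
have : 0 <= t by apply/ltW; near: t; exact: lt_nbhsr.
by near: t.
Unshelve. all: by end_near. Qed.

Section Moment.
Variables (u : R -> R -> R) (cu : continuous_L1 u).

Let ui t : 0 <= t -> mu.-integrable pos (EFin \o u t).
Proof. by case: cu => + _; exact. Qed.

Let norm_continuous : {in pos, continuous (fun t => \int[mu]_(x in pos) `|u t x|)}.
Proof.
apply: within_ge0_continuous; apply: (@L1_cvg_within _ _ 1 cu) => t t0 tge0 t00.
have it := ui tge0; have it0 := ui t00; rewrite mul1r.
have nt : mu.-integrable pos (EFin \o (fun x => `|u t x|)) := integrable_norm it.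
have nt0 : mu.-integrable pos (EFin \o (fun x => `|u t0 x|)) := integrable_norm it0.
have id : mu.-integrable pos (EFin \o (fun x => u t x - u t0 x)).
  by have := integrableB mpos it it0; exact: eq_integrable.
rewrite -RintegralB//; apply: le_trans (le_normr_Rintegral _ _) _ => //.
  by have := integrableB mpos nt nt0; exact: eq_integrable.
apply: le_Rintegral => //.
- apply: integrable_norm.
  by have := integrableB mpos nt nt0; exact: eq_integrable.
- exact: integrable_norm.
- by move=> x _; exact: ler_dist_dist.
Qed.

Variables (a : R -> R) (C : R).
Hypotheses (ma : measurable_fun pos a) (aC : forall x, 0 < x -> `|a x| <= C).

Let aC' x : pos x -> `|a x| <= C. Proof. by rewrite posE; exact: aC. Qed.

Lemma integrable_against t : 0 <= t ->
  mu.-integrable pos (EFin \o (fun x => u t x * a x)).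
Proof. by move=> t0; exact: (integrable_mulr mpos ma aC' (ui t0)). Qed.

Lemma integral_against_le t : 0 <= t ->
  `|integral_against u a t| <= C * \int[mu]_(x in pos) `|u t x|.
Proof.
move=> t0; have ia := integrable_against t0.
apply: le_trans (le_normr_Rintegral _ ia) _ => //.
have in1 := integrable_norm (ui t0).
rewrite -RintegralZl//; apply: le_Rintegral => //.
- exact: integrable_norm.
- exact: integrable_cstM.
- by move=> x x0; rewrite normrM mulrC ler_wpM2r// aC'.
Qed.

Lemma integral_against_cvg (t0 : R) : 0 <= t0 ->
  integral_against u a t @[t --> within [set t | 0 <= t] (nbhs t0)] -->
  integral_against u a t0.
Proof.
move: t0; apply: (@L1_cvg_within _ _ C cu) => t t0 tge0 t00.
have it := integrable_against tge0; have it0 := integrable_against t00.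
have id : mu.-integrable pos (EFin \o (fun x => u t x - u t0 x)).
  by have := integrableB mpos (ui tge0) (ui t00); exact: eq_integrable.
have ida : mu.-integrable pos (EFin \o (fun x => u t x * a x - u t0 x * a x)).
  by have := integrableB mpos it it0; exact: eq_integrable.
rewrite /integral_against -RintegralB//.
apply: le_trans (le_normr_Rintegral _ ida) _ => //.
have in1 := integrable_norm id.
rewrite -RintegralZl//; apply: le_Rintegral => //.
- exact: integrable_norm.
- exact: integrable_cstM.
- by move=> x x0; rewrite -mulrBl normrM mulrC ler_wpM2r// aC'.
Qed.

Lemma integral_against_continuous : {in pos, continuous (integral_against u a)}.
Proof. by apply: within_ge0_continuous => t0; exact: integral_against_cvg. Qed.

(** This is the dominating function in time for letting the smooth cutoffs tend to 1. It is
    integrable because the L^1 norm of [u t] is continuous in t > 0 and the derivative of [phi] has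
    compact support there. *)
Lemma integrable_norm_test phi : test1 phi ->
  mu.-integrable pos (EFin \o (fun t =>
    C * (`|derive1 phi t| * \int[mu]_(x in pos) `|u t x|))).
Proof.
move=> tphi; apply: integrable_cstM => //.
have cphi : continuous (fun t => `|derive1 phi t|).
  by move=> t; apply: cvg_norm; exact: test1_derive1_continuous.
have sphi : pos_supp (fun t => `|derive1 phi t|).
  have [p [q [p0 H]]] := derive1_pos_supp ((test1P phi).1 tphi).2.
  by exists p, q; split => // x /H ->; rewrite normr0.
have := integrable_pos_supp norm_continuous cphi sphi.
by apply: eq_integrable => // x _ /=; rewrite mulrC.
Qed.

End Moment.

Section WeakForm.
Variables (u w : R -> R -> R) (cu : continuous_L1 u).
Hypotheses (uw : weak_dt u w) (wi : forall T, 0 < T -> L1_L1 T w).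
Variables (a : R -> R) (C : R) (phi : R -> R).
Hypotheses (sa : forall n, diffn n pos a) (aC : forall x, 0 < x -> `|a x| <= C).
Hypothesis tphi : test1 phi.

Let sphi : smooth phi. Proof. by have [] := (test1P phi).1 tphi. Qed.

Let phi_supp : pos_supp phi. Proof. by have [] := (test1P phi).1 tphi. Qed.

(** The support of [phi] is contained in (0, T) for T = |q| + 1, where [w] is integrable by
    hypothesis. *)
Lemma integrable_mul_test :
  mu2.-integrable (pos `*` pos) (EFin \o (fun z : R * R => w z.1 z.2 * phi z.1)).
Proof.
have [p [q [p0 phi0]]] := phi_supp.
have [K K0 HK] := pos_supp_bounded (smooth_continuous sphi) phi_supp.
pose T := `|q| + 1.
have T0 : 0 < T by rewrite ltr_wpDl.
have mT : measurable (`]0%R, T[ `*` pos : set (measurableTypeR R * measurableTypeR R)).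
  exact: measurableX.
apply: (@integrable_extend _ _ _ mu2 _ (pos `*` pos)
  (fun z : R * R => w z.1 z.2 * phi z.1) mT mposX).
- by move=> [t x] [/= + x0]; rewrite in_itv/= => /andP[t0 _]; rewrite posE.
- move=> [t x] [/=]; rewrite posE => t0 x0 /not_andP[]// /negP.
  rewrite in_itv/= t0/= -leNgt => Tt; rewrite phi0 ?mulr0// => /andP[_].
  by rewrite leNgt (lt_le_trans _ Tt)// (le_lt_trans (ler_norm q))// ltrDl.
- apply: (@integrable_mulr _ _ _ mu2 _ (fun z : R * R => w z.1 z.2)
    (fun z : R * R => phi z.1) K mT) => //.
    apply: (@measurable_funTS _ _ _ _ _ (phi \o fst)).
    apply: measurableT_comp; last exact: measurable_fst.
    by apply: continuous_measurable_fun; exact: smooth_continuous.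
  exact: wi.
Qed.

Let psi (n : nat) (x : R) : R := a x * plateau n.+1%:R x.

Let ge1 n : 1 <= n.+1%:R :> R. Proof. by rewrite ler1n. Qed.

Let psi_smooth n : smooth (psi n).
Proof. exact: smooth_mul_plateau. Qed.

Let psi_le n x : 0 < x -> `|psi n x| <= C.
Proof.
move=> x0; rewrite normrM; have /andP[p0 p1] := plateau_itv n.+1%:R x.
rewrite (ger0_norm p0); apply: le_trans (aC x0).
by rewrite ler_piMr.
Qed.

Let psi_measurable n : measurable_fun pos (psi n).
Proof.
by apply: measurable_funTS; apply: continuous_measurable_fun;
  exact: smooth_continuous.
Qed.

Let psi_cvg x : 0 < x -> psi n x @[n --> \oo] --> a x.
Proof.
by move=> x0; rewrite -[X in _ --> X]mulr1; apply: cvgMr; exact: cvg_plateau.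
Qed.

Lemma measurable_smooth_pos : measurable_fun pos a.
Proof.
apply: (@measurable_fun_cvg _ _ _ _ psi) => // x; rewrite posE.
exact: psi_cvg.
Qed.

Let F (b : R -> R) (z : R * R) : R := w z.1 z.2 * phi z.1 * b z.2.

Let F_integrable (b : R -> R) :
  measurable_fun pos b -> (forall x, 0 < x -> `|b x| <= C) ->
  mu2.-integrable (pos `*` pos) (EFin \o F b).
Proof.
move=> mb bC; apply: (@integrable_mulr _ _ _ mu2 _
  (fun z : R * R => w z.1 z.2 * phi z.1) (fun z : R * R => b z.2) C mposX) => //.
- apply: (@measurable_comp _ _ _ _ _ _ pos) => //; first by move=> _ [z [_ z2] <-].
  by apply: measurable_funTS; exact: measurable_snd.
- by move=> [t x] [_] /=; rewrite posE; exact: bC.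
- exact: integrable_mul_test.
Qed.

Let weak_psi n :
  \int[mu]_(t in pos) (derive1 phi t * integral_against u (psi n) t) =
  - \int[mu2]_(z in pos `*` pos) F (psi n) z.
Proof.
have := uw (test2_tensor sphi phi_supp (psi_smooth n)
  (@pos_supp_mul_plateau _ a _ (ge1 n))).
rewrite dt_tensor// => H.
rewrite (Rintegral_prod_fst mpos mpos (F_integrable (psi_measurable n) (@psi_le n))).
transitivity (\int[mu]_(t in pos) \int[mu]_(x in pos)
    (u t x * (derive1 phi t * psi n x))).
  apply: eq_Rintegral => t /set_mem; rewrite posE => t0.
  rewrite -RintegralZl//; last first.
    by apply: (integrable_against cu (psi_measurable n) (@psi_le n)); exact: ltW.
  by apply: eq_Rintegral => x _; rewrite mulrCA.
rewrite H; congr (- _); apply: eq_Rintegral => t _; apply: eq_Rintegral => x _.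
by rewrite /F /= mulrA.
Qed.

(** The identity holds for each [psi n] and passes to the limit by domination. On the left this
    happens twice, with C |u| in x and [integrable_norm_test] in t; on the right once on the
    product, with C |w phi|. *)
Lemma weak_integral_against :
  \int[mu]_(t in pos) (integral_against u a t * derive1 phi t) =
  - \int[mu]_(t in pos) \int[mu]_(x in pos) (w t x * phi t * a x).
Proof.
have ma := measurable_smooth_pos.
rewrite -(Rintegral_prod_fst mpos mpos (F_integrable ma aC)).
have [|||||_ cvgl] := @dominated_Rintegral _ _ _ mu pos
  (fun n t => derive1 phi t * integral_against u (psi n) t)
  (fun t => derive1 phi t * integral_against u a t)
  (fun t => C * (`|derive1 phi t| * \int[mu]_(x in pos) `|u t x|)).
- exact: mpos.
- move=> n; apply: measurable_funM.
    by apply: measurable_funTS; apply: continuous_measurable_fun;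
      exact: test1_derive1_continuous.
  apply: open_continuous_measurable_fun; first exact: open_pos.
  exact: (integral_against_continuous cu (psi_measurable n) (@psi_le n)).
- move=> t; rewrite posE => t0; apply: cvgMr.
  have ut0 : mu.-integrable pos (EFin \o u t) by case: cu => + _; apply; exact: ltW.
  have [|||||_] := @dominated_Rintegral _ _ _ mu pos
    (fun n x => u t x * psi n x) (fun x => u t x * a x)
    (fun x => C * `|u t x|) => //.
  + move=> n; apply: measurable_funM; last exact: psi_measurable.
    by apply/measurable_EFinP; exact: measurable_int ut0.
  + by move=> x; rewrite posE => x0; apply: cvgMr; exact: psi_cvg.
  + move=> n x; rewrite posE => x0.
    by rewrite normrM mulrC ler_wpM2r// psi_le.
  + by apply: integrable_cstM => //; exact: integrable_norm.
- move=> n t; rewrite posE => t0; rewrite normrM mulrCA ler_wpM2l//.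
  by apply: (integral_against_le cu (psi_measurable n) (@psi_le n)); exact: ltW.
- exact: integrable_norm_test.
have [|||||_ cvgr] := @dominated_Rintegral _ _ _ mu2 (pos `*` pos)
  (fun n => F (psi n)) (F a) (fun z => C * `|w z.1 z.2 * phi z.1|).
- exact: mposX.
- move=> n; apply/measurable_EFinP.
  exact: measurable_int (F_integrable (psi_measurable n) (@psi_le n)).
- by move=> [t x] [_] /=; rewrite posE => x0; apply: cvgMr; exact: psi_cvg.
- move=> n [t x] [_] /=; rewrite posE => x0.
  by rewrite /F normrM mulrC ler_wpM2r// psi_le.
- apply: integrable_cstM => //; apply: integrable_norm.
  exact: integrable_mul_test.
move: cvgl; under eq_fun do rewrite weak_psi.
move=> cvgl; have := cvg_unique _ cvgl (cvgN cvgr).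
under eq_Rintegral do rewrite mulrC.
by apply; exact: Rhausdorff.
Qed.

End WeakForm.

End WeakMoments.

(** * Conservation laws *)

Section Conservation.
Context {R : realType}.
Local Notation mu := (@lebesgue_measure R).
Local Notation mu2 := (mu \x mu)%E.
Variables (beta0 theta : R) (u0 : R -> R) (u : R -> R -> R) (pc : R -> R).
Hypothesis beta0_gt0 : 0 < beta0.
Hypothesis hsol : solution_pair beta0 theta u0 u pc.

Let mpos := @measurable_pos R.

Let mposX : measurable (pos `*` pos : set (measurableTypeR R * measurableTypeR R)).
Proof. exact: measurableX. Qed.

Lemma moment_weight k (g : R -> R) :
  moment beta0 k g = \int[mu]_(x in pos) (g x * weight beta0 k x).
Proof.
by apply: eq_Rintegral => x _; rewrite /weight mulrCA mulrA.
Qed.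

Let ae_pos_of_itv (P : R -> Prop) :
  (forall n : nat, {ae mu, forall t, 0 < t < n.+1%:R -> P t}) ->
  {ae mu, forall t, 0 < t -> P t}.
Proof.
move=> /ae_foralln; apply: filterS => t H t0.
have [n tn] : exists n : nat, t < n.+1%:R.
  exists (Num.bound t); apply: lt_trans (archi_boundP (ltW t0)) _.
  by rewrite ltr_nat.
by apply: (H n); rewrite t0.
Qed.

Let L1_slice (f : R -> R -> R) : (forall T, 0 < T -> L1_L1 T f) ->
  {ae mu, forall t, 0 < t -> L1 (f t)}.
Proof.
move=> fi; apply: ae_pos_of_itv => n.
have mI : measurable (`]0%R, n.+1%:R[ : set (measurableTypeR R)) by [].
have := ae_integrable_fst mI mpos (fi n.+1%:R (ltr0Sn R n)).
by apply: filterS => t H t0; apply: H; rewrite /= in_itv.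
Qed.

(** Countably many thresholds 1/(n+1) give one null set of times. At the other times local Lipschitz
    continuity upgrades the bound from almost every x to every x, as the cancellation lemma
    requires. *)
Let u_bounded : {ae mu, forall t, 0 < t ->
  exists C : R, forall x, 0 < x -> `|u t x| <= C}.
Proof.
have H (n : nat) : exists C : R, {ae mu, forall t, n.+1%:R^-1 < t ->
    {ae mu, forall x, 0 < x -> `|u t x| <= C}}.
  by apply: (sol_bounded hsol); rewrite invr_gt0.
have {}H : {ae mu, forall t, forall n : nat, n.+1%:R^-1 < t ->
    exists C : R, {ae mu, forall x, 0 < x -> `|u t x| <= C}}.
  apply: ae_foralln => n; have [C HC] := H n.
  apply: (@filterS _ _ (ae_filter_ringOfSetsType mu) _ _ _ HC) => t Ht nt.
  by exists C; exact: Ht.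
apply: (@filterS _ _ (ae_filter_ringOfSetsType mu) _ _ _ H) => {}t {}H t0.
have [n nt] : exists n : nat, n.+1%:R^-1 < t.
  exists (Num.bound t^-1); rewrite -[X in _ < X]invrK ltf_pV2 ?posrE ?invr_gt0//.
  have tV0 : 0 <= t^-1 by rewrite invr_ge0 ltW.
  by apply: lt_trans (archi_boundP tV0) _; rewrite ltr_nat.
have [C HC] := H n nt; exists C; apply: ae_bounded_continuous HC.
exact/locally_lipschitz_continuous/(sol_lipschitz hsol).
Qed.

Section Weak.
Variables (k : nat) (C : R) (phi : R -> R) (w : R -> R -> R).
Hypothesis weightC : forall x, 0 < x -> weight beta0 k x <= C.
Hypothesis tphi : test1 phi.
Hypotheses (uw : weak_dt u w) (wi : forall T, 0 < T -> L1_L1 T w).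
Hypothesis wE : {ae mu2, forall z : R * R, 0 < z.1 -> 0 < z.2 ->
  w z.1 z.2 = pc z.1 * L (u z.1) z.2}.

Let weightC' x : 0 < x -> `|weight beta0 k x| <= C.
Proof.
by move=> x0; rewrite (gtr0_norm (weight_gt0 k beta0_gt0 x0)) weightC.
Qed.

Let mweight : measurable_fun pos (weight beta0 k).
Proof. exact: measurable_weight. Qed.

Let inner (t : R) : R :=
  \int[mu]_(x in pos) (w t x * phi t * weight beta0 k x).

Lemma integrable_inner : mu.-integrable pos (EFin \o inner).
Proof.
apply: (@integrable_Rintegral_fst _ _ _ _ R mu mu pos pos
  (fun z : R * R => w z.1 z.2 * phi z.1 * weight beta0 k z.2)) => //.
apply: (@integrable_mulr _ _ _ mu2 _ (fun z : R * R => w z.1 z.2 * phi z.1)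
  (fun z : R * R => weight beta0 k z.2) C mposX).
- apply: (@measurable_comp _ _ _ _ _ _ pos) => //; first by move=> _ [z [_ z2] <-].
  by apply: measurable_funTS; exact: measurable_snd.
- by move=> [t x] [_] /=; rewrite posE; exact: weightC'.
- exact: integrable_mul_test.
Qed.

(** The equation holds almost everywhere on the quadrant. For almost every t it holds on the slice,
    where [w t] and [L (u t)] are also integrable, so both integrals over x can be compared. *)
Lemma innerE : {ae mu, forall t, 0 < t ->
  inner t = phi t * pc t * moment beta0 k (L (u t))}.
Proof.
apply: (@filterS3 _ _ (ae_filter_ringOfSetsType mu) _ _ _ _ _
  (ae_slice wE) (L1_slice wi) (L1_slice (sol_Lu_L1 hsol))) => t wtE + + t0.
move=> /(_ t0) wti /(_ t0) Li.
have mw : measurable_fun pos (w t).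
  by apply/measurable_EFinP; exact: measurable_int wti.
have mL : measurable_fun pos (L (u t)).
  by apply/measurable_EFinP; exact: measurable_int Li.
rewrite moment_weight -RintegralZl//; last first.
  apply: (@integrable_mulr _ _ _ mu _ (L (u t)) (weight beta0 k) C mpos) => //.
  by move=> x; rewrite posE; exact: weightC'.
apply: ae_eq_Rintegral => //.
- by apply: measurable_funM => //; exact: measurable_funM.
- by apply: measurable_funM => //; exact: measurable_funM.
- apply: (@filterS _ _ (ae_filter_ringOfSetsType mu) _ _ _ wtE).
  move=> x /= H; rewrite posE => x0.
  by rewrite H//; ring.
Qed.

Lemma weak_moment :
  \int[mu]_(t in pos) (moment beta0 k (u t) * derive1 phi t) =
  - \int[mu]_(t in pos) inner t.
Proof.
rewrite -(weak_integral_against (sol_continuous hsol) uw wi _ weightC' tphi).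
  by apply: eq_Rintegral => t _; rewrite moment_weight.
by move=> n; exact: diffn_weight.
Qed.

End Weak.

Lemma moment_cvg k (C t0 : R) : (forall x, 0 < x -> weight beta0 k x <= C) ->
  0 <= t0 ->
  moment beta0 k (u t) @[t --> within [set t | 0 <= t] (nbhs t0)] -->
  moment beta0 k (u t0).
Proof.
move=> wC t00; under eq_fun do rewrite moment_weight.
rewrite moment_weight; apply: (@integral_against_cvg _ u _ _ C) => //.
- exact: sol_continuous hsol.
- exact: measurable_weight.
- by move=> x x0; rewrite (gtr0_norm (weight_gt0 k beta0_gt0 x0)) wC.
Qed.

(** Test functions do not see t = 0: the weak equation gives constancy on (0, oo) only, and
    continuity from the right carries the value to 0. *)
Lemma eq_initial_of_weakly_constant (F : R -> R) :
  (forall t0 : R, 0 <= t0 -> F t @[t --> within [set t | 0 <= t] (nbhs t0)] --> F t0) ->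
  (forall phi, test1 phi -> \int[mu]_(t in pos) (F t * derive1 phi t) = 0) ->
  forall t, 0 < t -> F t = F 0.
Proof.
move=> cF F0 t t0.
have Fcst := du_Bois_Reymond (within_ge0_continuous cF) F0.
apply/esym/eqP; rewrite -subr_eq0 -normr_le0; apply/ler_addgt0Pl => e e0.
rewrite addr0.
have /cvgrPdist_lt/(_ e e0) := cF 0 (lexx 0).
rewrite near_withinE => /nbhs_ballP[r /= r0 Hr].
have r20 : 0 < r / 2 by rewrite divr_gt0.
rewrite (Fcst t (r / 2))//; apply/ltW/Hr; last exact: ltW.
by rewrite /ball/= sub0r normrN gtr0_norm// ltr_pdivrMr// ltr_pMr// ltr1n.
Qed.

Let weight4 x : 0 < x -> weight beta0 4 x <= 16.
Proof. by move=> x0; case: (weight_le beta0_gt0 x0). Qed.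

Let weight6 x : 0 < x -> weight beta0 6 x <= 16.
Proof. by move=> x0; case: (weight_le beta0_gt0 x0). Qed.

Lemma energy_conserved t : 0 < t -> moment beta0 6 (u t) = moment beta0 6 (u 0).
Proof.
have [w [uw _ wi wE]] := sol_dtu hsol.
apply: (@eq_initial_of_weakly_constant (fun t => moment beta0 6 (u t))) =>
  [t0 t00|phi tphi]; first exact: moment_cvg weight6 t00.
rewrite (weak_moment weight6 tphi uw wi).
have inner0 : {ae mu, forall s, 0 < s ->
    \int[mu]_(x in pos) (w s x * phi s * weight beta0 6 x) = 0}.
  have H1 := innerE phi weight6 wi wE.
  have H2 := L1_slice (sol_Lu_L1 hsol).
  apply: (@filterS3 _ _ (ae_filter_ringOfSetsType mu) _ _ _ _ _ H1 H2 u_bounded).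
  move=> s + + + s0 => /(_ s0) -> /(_ s0) Li /(_ s0)[C uC].
  rewrite (moment6_L_eq0 beta0_gt0 uC _ Li) ?mulr0//.
  exact: sol_lipschitz hsol _ s0.
rewrite (@ae_eq_Rintegral _ _ _ mu pos _ (cst 0)) ?Rintegral_cst ?mul0r ?oppr0//.
- apply/measurable_EFinP; exact: measurable_int (integrable_inner weight6 tphi wi).
- apply: (@filterS _ _ (ae_filter_ringOfSetsType mu) _ _ _ inner0) => s.
  by rewrite posE.
Qed.

Lemma pc_cvg (t0 : R) : 0 <= t0 ->
  pc t @[t --> within [set t | 0 <= t] (nbhs t0)] --> pc t0.
Proof.
move=> t00; rewrite (_ : [set t | 0 <= t] = `[0, +oo[%classic); last first.
  by apply/seteqP; split => x /=; rewrite in_itv/= andbT.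
have /subspace_continuousP := sol_pc_continuous hsol; apply.
by rewrite /= in_itv/= t00.
Qed.

Lemma pc_moment4_conserved t : 0 < t ->
  pc t + moment beta0 4 (u t) = pc 0 + moment beta0 4 (u 0).
Proof.
have [w [uw _ wi wE]] := sol_dtu hsol.
apply: (@eq_initial_of_weakly_constant (fun t => pc t + moment beta0 4 (u t))) =>
  [t0 t00|phi tphi].
  by apply: cvgD; [exact: pc_cvg|exact: moment_cvg weight4 t00].
have [g [[mg _ _] pcg] gE] := sol_dpc hsol.
have cphi := test1_derive1_continuous tphi.
have sphi := derive1_pos_supp ((test1P phi).1 tphi).2.
have c1 : {in pos, continuous pc} by apply: within_ge0_continuous; exact: pc_cvg.
have c2 : {in pos, continuous (fun t => moment beta0 4 (u t))}.
  by apply: within_ge0_continuous => t0; exact: moment_cvg weight4.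
have i1 := integrable_pos_supp c1 cphi sphi.
have i2 := integrable_pos_supp c2 cphi sphi.
under eq_Rintegral do rewrite mulrDl.
rewrite RintegralD// (weak_moment weight4 tphi uw wi) pcg// -opprD.
have ii := integrable_inner weight4 tphi wi.
(* The weak derivative of [pc] is almost everywhere the negative of that of the fourth moment, so
   the two contributions cancel. Measurability of [g] comes from its local integrability. *)
have -> : \int[mu]_(s in pos) (g s * phi s) =
    \int[mu]_(s in pos) (-1 * \int[mu]_(x in pos) (w s x * phi s * weight beta0 4 x)).
  apply: ae_eq_Rintegral => //.
  - apply: measurable_funM => //; apply: measurable_funTS.
    by apply: continuous_measurable_fun; exact: test1_continuous.
  - by apply: measurable_funM => //; apply/measurable_EFinP; exact: measurable_int ii.
  - apply: (@filterS2 _ _ (ae_filter_ringOfSetsType mu) _ _ _ _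
      (innerE phi weight4 wi wE) gE) => s + +; rewrite posE => + + s0.
    by move=> /(_ s0) -> /(_ s0) ->; ring.
by rewrite RintegralZl// mulN1r addNr oppr0.
Qed.

End Conservation.

Theorem corollary2 (R : realType) (beta0 theta : R) (u0 : R -> R)
    (u : R -> R -> R) (pc : R -> R)
    (hbeta0 : 0 < beta0) (htheta : 0 < theta < 1)
    (hu0 : L1 u0) (hu0_theta : (theta_norm theta u0 < +oo)%E)
    (hsol : solution_pair beta0 theta u0 u pc) :
  let N := fun t : R => moment beta0 4 (u t) in
  let E := fun t : R => moment beta0 6 (u t) in
  (forall t : R, 0 < t -> E t = E 0) /\
  (forall t : R, 0 < t -> pc t + N t = pc 0 + N 0).
Proof.
split=> t t0; first exact: energy_conserved hbeta0 hsol t t0.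
exact: pc_moment4_conserved hbeta0 hsol t t0.
Qed.
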